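(* Consider the nonlinear system $\dot{x}=f(x,u)$, $y=h(x,u)$, $x(0)=x^0$, with state $x(t)\in\mathbb{R}^n$, input $u(t)\in U\subset\mathbb{R}^m$, output $y(t)\in\mathbb{R}^p$, and $f,h$ of class $C^2$. Suppose: (i) the system is uniformly observable for any input, i.e. there exist coordinates $\{x_{ij}: i=1,\dots,p,\ j=1,\dots,l_i\}$ with $1\le l_1\le\dots\le l_p$, $\sum_i l_i=n$, in which the system takes the observable form $y_i=x_{i1}+h_i(u)$, $\dot{x}_{ij}=x_{i,j+1}+f_{ij}(\underline{x}_j,u)$ for $j<l_i$, $\dot{x}_{il_i}=f_{il_i}(\underline{x}_{l_i},u)$, where $\underline{x}_j=(x_{11},\dots,x_{1,\min\{j,l_1\}},x_{21},\dots,x_{pj})$ (indices $i=1,\dots,p$, $k=1,\dots,\min\{j,l_i\}$). Equivalently $\dot{x}=\bar{A}x+\bar{f}(x,u)$, $y=\bar{C}x+\bar{h}(u)$, where $\bar{A}$ is block diagonal with $l_i\times l_i$ shift blocks (ones on the superdiagonal, zeros elsewhere), $\bar{C}$ is block diagonal with $1\times l_i$ blocks $[1\ 0\ \cdots\ 0]$, $\bar{f}$ stacks the $f_{ij}$ and $\bar{h}$ stacks the $h_i$. Without loss of generality the system is in this form, and there is $L$ such that for all $x,\xi\in\mathbb{R}^n$, $u\in U$: $|f_{i}(\underline{x}_j,u)-f_{i}(\underline{\xi}_j,u)|\le L|\underline{x}_j-\underline{\xi}_j|$ ($|\cdot|$ the Euclidean norm); (ii) the second derivative of $\bar{f}$ is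 bounded: $\left|\frac{\partial^2\bar{f}}{\partial x_i\partial x_j}(x,u)\xi_i\xi_j\right|\le L|\xi|^2$ for all $x,\xi\in\mathbb{R}^n$, $u\in U$ (summation over repeated indices); (iii) $x(t),y(t)$ are any state and output trajectories generated by $\dot{x}=\bar{A}x+\bar{f}(x,u)$, $y=\bar{C}x+\bar{h}(u)$; (iv) the $n\times n$ design matrix $G$ is invertible, and $\Gamma=GG'$; (v) $\hat{x}(t),P(t)$ solve the extended Kalman filter $\dot{\hat{x}}=f(\hat{x},u)+PC'(y-h(\hat{x},u))$, $\dot{P}=AP+PA'+\Gamma-PC'CP$, $\hat{x}(0)=\hat{x}^0$, $P(0)=P^0$, with $A(t)=\frac{\partial f}{\partial x}(\hat{x}(t),u(t))$, $C(t)=\frac{\partial h}{\partial x}(\hat{x}(t),u(t))$, where $P(0)$ is positive definite and $\tilde{x}(0)=x(0)-\hat{x}(0)$ is sufficiently small. Then $|x(t)-\hat{x}(t)|\to 0$ exponentially as $t\to\infty$.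
   Context: Local convergence of the extended Kalman filter for nonlinear systems that are uniformly observable for any input, $C^2$, Lipschitz in observable form, and with bounded second partial derivatives. *)

(* Defs.v *)
From HB Require Import structures.
From mathcomp Require Import all_boot all_order all_algebra.
From mathcomp Require Import all_classical all_reals all_analysis.
Set Implicit Arguments. Unset Strict Implicit. Unset Printing Implicit Defensive.
Import Order.TTheory GRing.Theory Num.Theory.
Import numFieldNormedType.Exports.
Local Open Scope classical_set_scope.
Local Open Scope ring_scope.

Definition dimn (p : nat) (l : 'I_p -> nat) : nat := (\sum_(i < p) l i)%N.

Section Defs.
Variables (R : realType) (p : nat) (l : 'I_p -> nat).
Local Notation n := (dimn l).

(* block index i (0-based) of the state coordinate k = x_{i,j} *)
Definition blk (k : 'I_n) : 'I_p := tagnat.sig1 k.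
(* position j-1 (0-based) of the state coordinate k = x_{i,j} in its block *)
Definition pos (k : 'I_n) : nat := tagnat.sig2 k.

Definition Abar : 'M[R]_n :=
  \matrix_(k, k') ((blk k == blk k') && (pos k' == (pos k).+1))%:R.
Definition Cbar : 'M[R]_(p, n) :=
  \matrix_(i, k) ((blk k == i) && (pos k == 0%N))%:R.
End Defs.

Definition enorm (R : realType) (d : nat) (v : 'cV[R]_d) : R :=
  Num.sqrt (\sum_(k < d) v k 0 ^+ 2).

Definition posdef (R : realType) (d : nat) (P : 'M[R]_d) : Prop :=
  P^T = P /\ forall v : 'cV[R]_d, v != 0 -> 0 < (v^T *m P *m v) 0 0.

Definition ecol (R : realType) (d : nat) (j : 'I_d) : 'cV[R]_d := delta_mx j 0.

Definition C2 (R : realType) (V W : normedModType R) (F : V -> W) : Prop :=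
  (forall v z, derivable F z v) /\
  (forall v w z, derivable ('D_v F) z w) /\
  (forall v w, continuous ('D_w ('D_v F))).

Section Jac.
Variables (R : realType) (n m q : nat).
Definition jac_x (F : 'cV[R]_n * 'cV[R]_m -> 'cV[R]_q) (x : 'cV[R]_n)
  (u : 'cV[R]_m) : 'M[R]_(q, n) :=
  \matrix_(i < q, j < n) ('D_(ecol R j, 0) F (x, u)) i 0.
Definition d2_x (F : 'cV[R]_n * 'cV[R]_m -> 'cV[R]_q) (i j : 'I_n)
  (x : 'cV[R]_n) (u : 'cV[R]_m) : 'cV[R]_q :=
  'D_(ecol R i, 0) ('D_(ecol R j, 0) F) (x, u).
End Jac.

Section Form.
Variables (R : realType) (p m : nat) (l : 'I_p -> nat).
Local Notation n := (dimn l).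
(* the sub-vector underline{x}_j relevant to coordinate k = x_{i,j}
   (j = pos k + 1): all coordinates x_{i',j'} with j' <= j, the other
   coordinates being set to 0 (this does not change Euclidean norms) *)
Definition underline (k : 'I_n) (v : 'cV[R]_n) : 'cV[R]_n :=
  \col_(k' < n) (if (pos k' <= pos k)%N then v k' 0 else 0).

Definition observable_form (U : set 'cV[R]_m)
  (fbar : 'cV[R]_n * 'cV[R]_m -> 'cV[R]_n) : Prop :=
  forall (k : 'I_n) (x xi : 'cV[R]_n) (u : 'cV[R]_m), U u ->
    underline k x = underline k xi -> fbar (x, u) k 0 = fbar (xi, u) k 0.

Definition lipschitz_form (U : set 'cV[R]_m)
  (fbar : 'cV[R]_n * 'cV[R]_m -> 'cV[R]_n) (L : R) : Prop :=
  forall (k : 'I_n) (x xi : 'cV[R]_n) (u : 'cV[R]_m), U u ->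
    `|fbar (x, u) k 0 - fbar (xi, u) k 0|
      <= L * enorm (underline k x - underline k xi).

Definition bounded_d2 (U : set 'cV[R]_m)
  (fbar : 'cV[R]_n * 'cV[R]_m -> 'cV[R]_n) (L : R) : Prop :=
  forall (x xi : 'cV[R]_n) (u : 'cV[R]_m), U u ->
    enorm (\sum_(i < n) \sum_(j < n) (xi i 0 * xi j 0) *: d2_x fbar i j x u)
      <= L * enorm xi ^+ 2.
End Form.

(* Main.v *)
(** Write e := x - xhat, J := Abar and H := C^T C, where C = Cbar is constant.
    Everything rests on one barrier principle for symmetric matrix functions D
    on [0, +oo): if D(0) > 0 and v^T D'(t) v > 0 for every v <> 0 in the kernel
    of D(t) whenever D(t) >= 0, then D stays positive definite.

    Upper bound on P.  The Jacobian A is J plus a bounded matrix that is lower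
    triangular with respect to the positions in the blocks; for such A there is
    a constant S > 0 with H - S A - A^T S >= delta I, as for a high-gain
    observer.  The barrier D = (eps S)^-1 - P then yields P <= M I.

    Decay of the error.  Instead of differentiating e^T P^-1 e, which would
    require P to be invertible, apply the barrier principle to
    D = P - mu exp(a t) e e^T.  If D(t) >= 0 for all t then
    mu exp(a t) |e|^4 <= e^T P e <= M |e|^2, hence |e|^2 <= (M / mu) exp(- a t). *)

Require Import Defs.
From HB Require Import structures.
From mathcomp Require Import all_boot all_order all_algebra.
From mathcomp Require Import all_classical all_reals all_analysis.
From mathcomp Require Import ring lra zify.
Set Implicit Arguments.
Unset Strict Implicit.
Unset Printing Implicit Defensive.
Import Order.TTheory GRing.Theory Num.Theory.
Import numFieldNormedType.Exports.
Local Open Scope classical_set_scope.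
Local Open Scope ring_scope.

(** * Quadratic forms *)

(** The threshold on the initial error has to be fixed before the input and the trajectories are
    known. Hence [S], [delta], [M] and [mu] may depend only on [L], [G], [P0] and the dimensions,
    which dictates the quantifier order of the main lemmas; in particular [M] cannot come from
    compactness along one solution. The size of the error needs no separate continuation argument:
    as long as P - mu exp(a t) e e^T >= 0, testing this matrix on e gives |e|^2 <= M / mu. A large
    [mu] thus makes the quadratic remainder negligible against [Gamma], and the price is paid once,
    at time 0, as |e(0)|^2 < m / mu where P0 >= m I. Two gaps in the data must be closed on the way.
    The barrier principle concerns symmetric matrices, while the filter equation does not say that P
    stays symmetric. And [C2] speaks of directional derivatives only, so their linearity in the
    direction has to precede any Taylor estimate. *)

Definition dotp {R : realType} {n : nat} (u v : 'cV[R]_n) : R :=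
  (u^T *m v) 0 0.

Section DotProduct.
Context {R : realType} {n : nat}.
Implicit Types (u v w : 'cV[R]_n) (B : 'M[R]_n).

Lemma dotpE u v : dotp u v = \sum_i u i 0 * v i 0.
Proof. by rewrite /dotp mxE; apply: eq_bigr => i _; rewrite mxE. Qed.

Lemma dotpC u v : dotp u v = dotp v u.
Proof. by rewrite !dotpE; apply: eq_bigr => i _; rewrite mulrC. Qed.

Lemma dotpDr u v w : dotp u (v + w) = dotp u v + dotp u w.
Proof. by rewrite /dotp mulmxDr mxE. Qed.

Lemma dotpDl u v w : dotp (u + v) w = dotp u w + dotp v w.
Proof. by rewrite dotpC dotpDr !(dotpC w). Qed.

Lemma dotpZr a u v : dotp u (a *: v) = a * dotp u v.
Proof. by rewrite /dotp -scalemxAr mxE. Qed.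

Lemma dotpZl a u v : dotp (a *: u) v = a * dotp u v.
Proof. by rewrite dotpC dotpZr dotpC. Qed.

Lemma dotpNr u v : dotp u (- v) = - dotp u v.
Proof. by rewrite -scaleN1r dotpZr mulN1r. Qed.

Lemma dotpNl u v : dotp (- u) v = - dotp u v.
Proof. by rewrite dotpC dotpNr dotpC. Qed.

Lemma dotpBr u v w : dotp u (v - w) = dotp u v - dotp u w.
Proof. by rewrite dotpDr dotpNr. Qed.

Lemma dotpBl u v w : dotp (u - v) w = dotp u w - dotp v w.
Proof. by rewrite dotpDl dotpNl. Qed.

Lemma dotp0r u : dotp u 0 = 0.
Proof. by rewrite /dotp mulmx0 mxE. Qed.

Lemma dotp_quadE B v : (v^T *m B *m v) 0 0 = dotp v (B *m v).
Proof. by rewrite /dotp mulmxA. Qed.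

Lemma dotp_quad_sumE B u v :
  dotp u (B *m v) = \sum_i \sum_j u i 0 * v j 0 * B i j.
Proof.
rewrite dotpE; apply: eq_bigr => i _; rewrite mxE mulr_sumr.
by apply: eq_bigr => j _; ring.
Qed.

Lemma dotp_ge0 v : 0 <= dotp v v.
Proof. by rewrite dotpE; apply: sumr_ge0 => i _; rewrite -expr2 sqr_ge0. Qed.

Lemma dotp_eq0 v : (dotp v v == 0) = (v == 0).
Proof.
apply/idP/eqP => [|->]; last by rewrite dotp0r.
rewrite dotpE psumr_eq0 => [/allP v0|i _]; last by rewrite -expr2 sqr_ge0.
apply/matrixP => i j; rewrite ord1 mxE.
by have := v0 i (mem_index_enum _); rewrite -expr2 /= sqrf_eq0 => /eqP.
Qed.

Lemma dotp_gt0 v : v != 0 -> 0 < dotp v v.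
Proof. by move=> v0; rewrite lt_neqAle eq_sym dotp_eq0 v0 dotp_ge0. Qed.

Lemma enorm_sqr v : enorm v ^+ 2 = dotp v v.
Proof.
rewrite /enorm sqr_sqrtr; last by apply: sumr_ge0 => i _; rewrite sqr_ge0.
by rewrite dotpE; apply: eq_bigr => i _; rewrite expr2.
Qed.

Lemma enorm_ge0 v : 0 <= enorm v.
Proof. exact: sqrtr_ge0. Qed.

Lemma enormE v : enorm v = Num.sqrt (dotp v v).
Proof. by rewrite -enorm_sqr sqrtr_sqr ger0_norm// enorm_ge0. Qed.

Lemma coord_le_enorm v i : `|v i 0| <= enorm v.
Proof.
rewrite enormE -sqrtr_sqr ler_wsqrtr// dotpE (bigD1 i)//= -expr2 lerDl.
by apply: sumr_ge0 => j _; rewrite -expr2 sqr_ge0.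
Qed.

End DotProduct.

Lemma dotp_mulmxl {R : realType} {m n : nat} (A : 'M[R]_(m, n)) u v :
  dotp (A *m u) v = dotp u (A^T *m v).
Proof. by rewrite /dotp trmx_mul mulmxA. Qed.

Section Psd.
Context {R : realType} {n : nat}.
Implicit Types (u v w : 'cV[R]_n) (B : 'M[R]_n).

Definition psd B := forall v, 0 <= dotp v (B *m v).

Lemma dotp_sym B u v : B^T = B -> dotp u (B *m v) = dotp v (B *m u).
Proof. by move=> symB; rewrite dotpC dotp_mulmxl symB. Qed.

Lemma psd_cauchy_schwarz B u v : B^T = B -> psd B ->
  dotp u (B *m v) ^+ 2 <= dotp u (B *m u) * dotp v (B *m v).
Proof.
move=> symB psdB.
have key x : 0 <= dotp u (B *m u) - 2 * x * dotp u (B *m v)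
                  + x ^+ 2 * dotp v (B *m v).
  have := psdB (u - x *: v).
  rewrite mulmxBr -scalemxAr dotpBl !dotpBr !dotpZl !dotpZr (dotp_sym v u)//.
  by move=> h; apply: le_trans h _; rewrite le_eqVlt; apply/orP; left; apply/eqP; ring.
set a := dotp u (B *m u) in key *; set b := dotp u (B *m v) in key *.
set c := dotp v (B *m v) in key *.
have c0 : 0 <= c by exact: psdB.
have a0 : 0 <= a by exact: psdB.
clearbody a b c; clear symB psdB.
have [c_eq0|c_neq0] := eqVneq c 0.
  suff -> : b = 0 by rewrite expr0n mulr_ge0.
  apply/eqP; apply: contraT => b0.
  (* With [c = 0] the inequality [key] is affine in its parameter; this value turns it into 0 <= a -
     2 (a + 1), which is absurd. *)
  have := key ((a + 1) / b); rewrite c_eq0 mulr0 addr0.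
  have -> : 2 * ((a + 1) / b) * b = 2 * (a + 1) by field.
  by move=> h; exfalso; lra.
have cp : 0 < c by rewrite lt_neqAle eq_sym c_neq0.
have := key (b / c).
have -> : a - 2 * (b / c) * b + (b / c) ^+ 2 * c = a - b ^+ 2 / c by field.
by rewrite subr_ge0 ler_pdivrMr.
Qed.

Lemma dotp_cauchy_schwarz u v : dotp u v ^+ 2 <= dotp u u * dotp v v.
Proof.
have h := @psd_cauchy_schwarz 1%:M u v; rewrite !mul1mx in h.
by apply: h => [|w]; rewrite ?trmx1// mul1mx dotp_ge0.
Qed.

(** Cauchy-Schwarz for the form of [B], applied to [B *m v] and [v], bounds |B v|^4 by 0. This turns
    a vanishing value of the form into the kernel vector that the barrier principle works with. *)
Lemma psd_null B v : B^T = B -> psd B -> dotp v (B *m v) = 0 -> B *m v = 0.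
Proof.
move=> symB psdB vBv; apply/eqP; rewrite -dotp_eq0 -sqrf_eq0 eq_le sqr_ge0 andbT.
by have := @psd_cauchy_schwarz B (B *m v) v symB psdB; rewrite vBv mulr0.
Qed.

Lemma posdefP B : posdef B <->
  B^T = B /\ forall v, v != 0 -> 0 < dotp v (B *m v).
Proof.
by split=> -[symB h]; split=> // v v0; have := h v v0; rewrite dotp_quadE.
Qed.

Lemma posdef_psd B : posdef B -> psd B.
Proof.
move=> /posdefP[_ h] v; have [->|v0] := eqVneq v 0; first by rewrite mulmx0 dotp0r.
exact/ltW/h.
Qed.

(** Each product of two weighted coordinates is split by 2xy <= x^2 + y^2. The weights [s] allow
    entries of very different orders of magnitude to be compared with one diagonal form. *)
Lemma quad_weighted_bound B (s : 'I_n -> R) (c : R) v : 0 <= c ->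
  (forall i j, `|B i j| <= c * `|s i * s j|) ->
  `|dotp v (B *m v)| <= c * n%:R * \sum_i (s i * v i 0) ^+ 2.
Proof.
move=> c0 hB; rewrite dotp_quad_sumE.
apply: (@le_trans _ _ (\sum_i \sum_j
    (c / 2 * (s i * v i 0) ^+ 2 + c / 2 * (s j * v j 0) ^+ 2))).
  apply: le_trans (ler_norm_sum _ _ _) _; apply: ler_sum => i _.
  apply: le_trans (ler_norm_sum _ _ _) _; apply: ler_sum => j _.
  rewrite normrM.
  apply: (@le_trans _ _ (`|v i 0 * v j 0| * (c * `|s i * s j|))).
    by rewrite ler_wpM2l.
  have sq k : (s k * v k 0) ^+ 2 = (`|s k| * `|v k 0|) ^+ 2.
    by rewrite -normrM real_normK ?num_real.
  rewrite !normrM !sq.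
  have := sqr_ge0 (`|s i| * `|v i 0| - `|s j| * `|v j 0|).
  move=> /(mulr_ge0 c0) h; rewrite -subr_ge0.
  rewrite [leRHS](_ : _ = c * (`|s i| * `|v i 0| - `|s j| * `|v j 0|) ^+ 2 / 2);
    by rewrite ?divr_ge0//; field.
under eq_bigr do rewrite big_split /= sumr_const card_ord -mulr_sumr.
rewrite big_split/= sumr_const card_ord sumrMnl -mulr_sumr.
rewrite -[X in X + _ <= _]mulr_natl -[X in _ + X <= _]mulr_natl.
by rewrite le_eqVlt; apply/orP; left; apply/eqP; field.
Qed.

Lemma quad_bound B (c : R) v : 0 <= c -> (forall i j, `|B i j| <= c) ->
  `|dotp v (B *m v)| <= c * n%:R * dotp v v.
Proof.
move=> c0 hB; have := @quad_weighted_bound B (fun=> 1) c v c0.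
under eq_bigr do rewrite mul1r expr2.
by rewrite -dotpE; apply => i j; rewrite mul1r normr1 mulr1.
Qed.

Lemma entry_bounded B : exists2 c, 0 <= c & forall i j, `|B i j| <= c.
Proof.
exists (\sum_i \sum_j `|B i j|) => [|i j].
  by apply: sumr_ge0 => i _; apply: sumr_ge0.
rewrite (bigD1 i)//= (bigD1 j)//= -addrA lerDl addr_ge0//.
  by apply: sumr_ge0.
by apply: sumr_ge0 => k _; apply: sumr_ge0.
Qed.

Lemma quad_bounded B : exists2 c, 0 < c &
  forall v, dotp v (B *m v) <= c * dotp v v.
Proof.
have [c c0 hc] := entry_bounded B.
exists (c * n%:R + 1) => [|v]; first by rewrite ltr_wpDl// mulr_ge0.
apply: le_trans (ler_norm _) _; apply: le_trans (quad_bound v c0 hc) _.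
by rewrite ler_wpM2r ?dotp_ge0// lerDl.
Qed.

Lemma posdef_unitmx B : posdef B -> B \in unitmx.
Proof.
move=> /posdefP[symB h]; rewrite -row_free_unit -kermx_eq0; apply/negPn/negP.
move=> /rowV0Pn[w /sub_kermxP wB w0].
have v0 : w^T != 0 by rewrite -(inj_eq trmx_inj) trmxK trmx0.
have := h _ v0; rewrite -symB -trmx_mul wB trmx0 dotp0r.
by rewrite ltxx.
Qed.

Lemma posdef_invmx B : posdef B -> posdef (invmx B).
Proof.
move=> pB; have uB := posdef_unitmx pB; have /posdefP[symB h] := pB.
have symI : (invmx B)^T = invmx B by rewrite trmx_inv symB.
apply/posdefP; split=> // v v0.
have -> : dotp v (invmx B *m v) = dotp (invmx B *m v) (B *m (invmx B *m v)).
  by rewrite mulmxA mulmxV// mul1mx dotpC.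
apply: h; apply: contra_neq v0 => e; have := congr1 (mulmx B) e.
by rewrite mulmxA mulmxV// mul1mx mulmx0.
Qed.

(* Cauchy-Schwarz for the form of B, applied to v and B^-1 v, makes a bound
   on B^-1 into a lower bound on B: no compactness of the sphere is needed. *)
Lemma posdef_coercive B : posdef B ->
  exists2 c, 0 < c & forall v, c * dotp v v <= dotp v (B *m v).
Proof.
move=> pB; have uB := posdef_unitmx pB; have /posdefP[symB h] := pB.
have [c c0 hc] := quad_bounded (invmx B).
exists c^-1 => [|v]; first by rewrite invr_gt0.
have [->|v0] := eqVneq v 0; first by rewrite mulmx0 !dotp0r mulr0.
have vv := dotp_gt0 v0.
have := psd_cauchy_schwarz v (invmx B *m v) symB (posdef_psd pB).
rewrite mulmxA mulmxV// mul1mx (dotpC _ v) => cs.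
rewrite mulrC ler_pdivrMr// -(ler_pM2r vv) -expr2; apply: le_trans cs _.
rewrite -mulrA ler_wpM2l ?posdef_psd//.
Qed.

End Psd.

Lemma gram_coercive {R : realType} {n : nat} (G : 'M[R]_n) : G \in unitmx ->
  exists2 c, 0 < c & forall v : 'cV[R]_n, c * dotp v v <= dotp v (G *m G^T *m v).
Proof.
move=> uG; apply: posdef_coercive; apply/posdefP; split.
  by rewrite trmx_mul trmxK.
move=> v v0; rewrite -mulmxA -{1}(trmxK G) -dotp_mulmxl dotp_gt0//.
apply: contra_neq v0 => e; have := congr1 (mulmx (invmx G^T)) e.
by rewrite mulmxA mulVmx ?unitmx_tr// mul1mx mulmx0.
Qed.

(** * A constant Lyapunov matrix for the observable form *)

Section Coordinates.
Context {p : nat} (l : 'I_p -> nat).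
Local Notation n := (dimn l).
Implicit Types k : 'I_n.

Lemma blk_pos_inj k k' : blk k = blk k' -> pos k = pos k' -> k = k'.
Proof.
move=> eb ep; rewrite -(tagnat.sig2K k) -(tagnat.sig2K k').
by apply/val_inj/eqP; rewrite tagnat.eq_Rank; apply/andP; split; apply/eqP.
Qed.

Lemma pos_lt k : (pos k < n)%N.
Proof.
apply: (@leq_trans (l (blk k))); first exact: ltn_ord.
by rewrite /dimn (bigD1 (blk k))//= leq_addr.
Qed.

Lemma pos_pred k j : pos k = j.+1 -> exists2 k' : 'I_n, blk k' = blk k & pos k' = j.
Proof.
move=> kj; have jl : (j < l (blk k))%N.
  have : (pos k < l (blk k))%N by exact: ltn_ord.
  by rewrite kj => /ltnW.
exists (@tagnat.Rank _ l _ (Ordinal jl)); first by rewrite /blk tagnat.Rank1K.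
by rewrite /pos tagnat.Rank2K.
Qed.

End Coordinates.

Section ObservabilityLyapunov.
Context {R : realType} {p : nat} (l : 'I_p -> nat).
Local Notation n := (dimn l).
Local Notation J := (Abar R l).
Local Notation C := (Cbar R l).
Implicit Types (k : 'I_n) (v : 'cV[R]_n).

Lemma Abar_norm k k' : `|J k k'| <= 1.
Proof. by rewrite mxE; case: (_ && _); rewrite ?normr1 ?normr0 ?ler01. Qed.

Lemma Abar_neq0 k k' : J k k' != 0 -> blk k' = blk k /\ pos k' = (pos k).+1.
Proof.
rewrite mxE; case: andP => [[/eqP -> /eqP ->]//|]; by rewrite eqxx.
Qed.

(** A coordinate that is not the head of its block has exactly one predecessor, so the product is
    diagonal and the shifted weight returns to [b (pos k)]. It vanishes exactly at the heads, which
    [Cbar_gram] supplies. *)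
Lemma Abar_gram (b : nat -> R) k k' :
  (J^T *m diag_mx (\row_j b (pos j).+1) *m J) k k'
  = ((k == k') && (0 < pos k)%N)%:R * b (pos k).
Proof.
rewrite -mulmxA mul_diag_mx mxE; under eq_bigr do rewrite !mxE.
have [<-{k'}|kk'] := eqVneq k k'; last first.
  rewrite /= mul0r big1// => j _.
  case: (blk j =P blk k) => [jk|_]; last by rewrite mul0r.
  case: (pos k =P _) => [pk|_]; last by rewrite mul0r.
  case: (blk j =P _) => [jk'|_]; last by rewrite !mulr0.
  case: (pos k' =P _) => [pk'|_]; last by rewrite !mulr0.
  by case/eqP: kk'; apply: blk_pos_inj; rewrite ?pk ?pk'// -jk.
case pk : (pos k) => [|m].
  by rewrite /= mul0r big1// => j _; rewrite andbF mul0r.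
have [j0 bj0 pj0] := pos_pred pk.
rewrite (bigD1 j0)//= bj0 pj0 !eqxx !mul1r mulr1 big1 ?addr0// => j jj0.
case: (blk j =P blk k) => [jk|_]; last by rewrite mul0r.
case: (m.+1 =P _) => [[pjk]|_]; last by rewrite mul0r.
by case/eqP: jj0; apply: blk_pos_inj; rewrite ?bj0 ?pj0.
Qed.

Lemma Cbar_gram k k' : (C^T *m C) k k' = ((k == k') && (pos k == 0%N))%:R.
Proof.
rewrite mxE (bigD1 (blk k))//= !mxE eqxx/= big1 ?addr0 => [|i ik]; last first.
  by rewrite !mxE eq_sym (negbTE ik) mul0r.
have [<-|kk'] := eqVneq k k'; first by rewrite eqxx/= -natrM mulnb andbb.
case: (pos k =P 0%N) => [pk|_]; last by rewrite mul0r.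
case: (blk k' =P _) => [bk|_]; last by rewrite mulr0.
case: (pos k' =P 0%N) => [pk'|_]; last by rewrite mulr0.
by case/eqP: kk'; apply: blk_pos_inj; rewrite ?pk ?pk'.
Qed.

(* With a_j = eta^(2 alpha j), b_j = eta^(2 beta j) and eta small, the matrix is
   S = D_a - D_b J - J^T D_b.  The product J^T D_b J contributes b_j on the
   diagonal and C^T C contributes b_0 = 1; all the other terms are smaller by a
   factor eta because beta is strictly increasing and strictly concave on
   [0, n + 2] and alpha lies just above the midpoints of consecutive values of
   beta. *)
Let N := n.+2.
Let beta (j : nat) : nat := (4 * j * (2 * N - j))%N.
Let alpha (j : nat) : nat := (2 * j * (2 * N - j) + 2 * j.+1 * (2 * N - j.+1) + 1)%N.

Let beta_le i j : (i <= j)%N -> (j <= N)%N -> (beta i <= beta j)%N.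
Proof. rewrite /beta => ij jN; nia. Qed.

Let beta_lt j : (j < N)%N -> (beta j + 4 <= beta j.+1)%N.
Proof. rewrite /beta => jN; nia. Qed.

(** The second difference of [beta] is -8. The margin 6 is exactly what [alpha_concave] consumes
    after substituting [alphaE], which explains the factor 4 in [beta]. *)
Let beta_concave j : (j.+2 <= N)%N -> (beta j + beta j.+2 + 6 <= 2 * beta j.+1)%N.
Proof.
rewrite /beta => jN.
have [d ->] : exists d, N = (j.+2 + d)%N by exists (N - j.+2)%N; rewrite subnKC.
rewrite (_ : 2 * (j.+2 + d) - j = j + 4 + 2 * d)%N; last by lia.
rewrite (_ : 2 * (j.+2 + d) - j.+1 = j + 3 + 2 * d)%N; last by lia.
rewrite (_ : 2 * (j.+2 + d) - j.+2 = j + 2 + 2 * d)%N; last by lia.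
lia.
Qed.

Let alphaE j : (2 * alpha j = beta j + beta j.+1 + 2)%N.
Proof. rewrite /alpha /beta; lia. Qed.

(** This makes S positive definite: an entry b_(j+1) of D_b J is smaller, by a factor eta, than the
    geometric mean of the diagonal entries a_j and a_(j+1). *)
Let alpha_concave j : (j.+2 <= N)%N -> (alpha j + alpha j.+1 + 1 <= 2 * beta j.+1)%N.
Proof.
by move=> /beta_concave; have := alphaE j; have := alphaE j.+1; lia.
Qed.

Lemma geometric_weights (eta : R) (s : 'I_n -> nat) : 0 < eta -> eta <= 1 ->
  exists2 c, 0 < c &
    forall v, c * dotp v v <= \sum_k (eta ^+ s k * v k 0) ^+ 2.
Proof.
(* Since [eta <= 1], the product of all the weights lies below each of them and serves as a common
   lower bound. *)
move=> e0 e1; have e0' := ltW e0; exists ((eta ^+ (\sum_k s k)%N) ^+ 2) => [|v].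
  by rewrite !exprn_gt0.
rewrite dotpE mulr_sumr; apply: ler_sum => k _.
rewrite -expr2 exprMn ler_wpM2r ?sqr_ge0// lerXn2r ?nnegrE ?exprn_ge0//.
rewrite ler_wiXn2l//.
by rewrite (bigD1 k)//= leq_addr.
Qed.

Let weight_bound (eta x K : R) m i j : 0 < eta -> eta <= 1 -> 0 <= K -> `|x| <= K ->
  (i + j + 1 <= m)%N -> `|eta ^+ m * x| <= K * eta * `|eta ^+ i * eta ^+ j|.
Proof.
move=> e0 e1 K0 xK ijm; have e0' := ltW e0; rewrite normrM mulrC -mulrA ler_pM// -exprD normrX.
by rewrite normrX gtr0_norm// -exprS ler_wiXn2l//; lia.
Qed.

(** [S] and [delta] depend on [K] but not on [F], so a single constant matrix handles the Jacobian
    at all times and along all trajectories. *)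
Lemma observability_lyapunov (K : R) : 0 <= K ->
  exists (S : 'M[R]_n) (delta : R), [/\ posdef S, 0 < delta &
    forall F : 'M[R]_n, (forall k k', `|F k k'| <= K) ->
      (forall k k', (pos k < pos k')%N -> F k k' = 0) ->
      forall v, delta * dotp v v <=
        dotp (C *m v) (C *m v) - 2 * dotp v (S *m ((J + F) *m v))].
Proof.
(* [K + 1] bounds the entries of [J + F]. The error matrix [E] below has three summands: one
   contributes a single term per entry, the other two a sum of [n] terms each, whence 1 + 2n. *)
move=> K0; pose c := (K + 1) * (1 + 2 * n%:R).
have n0 : 0 <= n%:R :> R by rewrite ler0n.
have K1 : 0 <= K + 1 by lra.
have c1 : 1 <= c.
  by rewrite -[X in X <= _]mulr1 ler_pM//; lra.
have cn0 : 0 <= c * n%:R by rewrite mulr_ge0//; lra.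
(* Chosen so that 2 c eta n <= 1/2: the error terms consume at most half of the diagonal sum. The
   added 4 keeps [eta] defined and at most 1 even when n = 0. *)
pose eta := (4 * (c * n%:R) + 4)^-1.
have e0 : 0 < eta by rewrite invr_gt0; lra.
have eE : eta * (4 * (c * n%:R) + 4) = 1 by rewrite mulVf//; lra.
have e1 : eta <= 1 by rewrite invf_le1; lra.
have cne : 2 * (c * eta) * n%:R <= 2^-1.
  rewrite (_ : _ * n%:R = 2^-1 * (eta * (4 * (c * n%:R)))); last by field.
  rewrite -[leRHS]mulr1 ler_pM2l ?invr_gt0// -[X in _ <= X]eE ler_pM2l//; lra.
have ne : 2 * eta * n%:R <= 2^-1.
  apply: le_trans cne; rewrite ler_wpM2r// ler_pM2l// ler_peMl// ltW//.
pose a j := eta ^+ (2 * alpha j); pose b j := eta ^+ (2 * beta j).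
pose Da : 'M[R]_n := diag_mx (\row_k a (pos k)).
pose Db : 'M[R]_n := diag_mx (\row_k b (pos k).+1).
pose S := Da - Db *m J - J^T *m Db.
have symS : S^T = S.
  by rewrite /S 2!raddfB/= !trmx_mul trmxK !tr_diag_mx addrAC.
have posN k : ((pos k).+3 <= N)%N by rewrite /N !ltnS pos_lt.
have DaE v : dotp v (Da *m v) = \sum_k (eta ^+ alpha (pos k) * v k 0) ^+ 2.
  rewrite dotpE; apply: eq_bigr => k _.
  by rewrite mul_diag_mx !mxE /a mulnC exprM mulrCA -expr2 exprMn.
have posS : posdef S.
  apply/posdefP; split=> // v v0.
  have [d d0 hd] := geometric_weights (fun k => alpha (pos k)) e0 e1.
  have DbJ : `|dotp v (Db *m J *m v)| <=
      eta * n%:R * \sum_k (eta ^+ alpha (pos k) * v k 0) ^+ 2.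
    apply: quad_weighted_bound => [|k k']; first exact: ltW.
    rewrite mul_diag_mx mxE [X in X * _]mxE.
    have [->|/Abar_neq0[_ pk']] := eqVneq (J k k') 0.
      by rewrite mulr0 normr0 mulr_ge0// ltW.
    rewrite -[X in _ <= X * _]mul1r; apply: weight_bound => //; first exact: Abar_norm.
    by rewrite pk' alpha_concave// ltnW.
  rewrite /S !mulmxBl !dotpBr -[J^T *m Db *m v]mulmxA.
  rewrite [dotp v (J^T *m _)]dotpC dotp_mulmxl trmxK.
  have -> : dotp (Db *m v) (J *m v) = dotp v (Db *m J *m v).
    by rewrite dotp_mulmxl tr_diag_mx mulmxA.
  have := hd v; have vv := dotp_gt0 v0; have := mulr_gt0 d0 vv; rewrite DaE.
  move: DbJ; set s := \sum_k _ => h1 h2 h3.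
  have h4 : 0 < s by exact: lt_le_trans h3.
  have h5 : 2 * eta * n%:R * s <= 2^-1 * s by rewrite ler_pM2r.
  by have := ler_norm (dotp v (Db *m J *m v)); lra.
have [d d0 hd] := geometric_weights (fun k => beta (pos k)) e0 e1.
exists S, (2^-1 * d); split=> //; first by rewrite mulr_gt0// invr_gt0.
move=> F FK F0 v.
pose A := J + F.
have AK k k' : `|A k k'| <= K + 1.
  by rewrite mxE addrC (le_trans (ler_normD _ _))// lerD// Abar_norm.
have A0 k k' : A k k' != 0 -> (pos k' <= (pos k).+1)%N.
  rewrite leqNgt; apply: contra_neqN => kk'; rewrite mxE.
  have [->|/Abar_neq0[_ pk']] := eqVneq (J k k') 0.
    by rewrite add0r F0// ltnW.
  by rewrite pk' ltnn in kk'.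
have Fpos k k' : F k k' != 0 -> (pos k' <= pos k)%N.
  by rewrite leqNgt; apply: contra_neqN => /F0.
(* [E] is what remains of S A once the useful term - J^T D_b J is set apart. *)
pose E := Da *m A - Db *m J *m A - J^T *m Db *m F.
have SAE : S *m (A *m v) = E *m v - J^T *m Db *m J *m v.
  rewrite mulmxA -mulmxBl; congr (_ *m v).
  by rewrite /S /E !mulmxBl -!addrA; congr (_ + (_ + _)); rewrite mulmxDr opprD addrC.
have DbE : dotp v (C^T *m C *m v) + 2 * dotp v (J^T *m Db *m J *m v) >=
    \sum_k (eta ^+ beta (pos k) * v k 0) ^+ 2.
  rewrite !dotp_quad_sumE mulr_sumr -big_split/=; apply: ler_sum => k _.
  rewrite (bigD1 k)//= [X in _ + 2 * X](bigD1 k)//=.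
  rewrite !big1 ?addr0 => [|k' kk'|k' kk']; last 2 first.
  - by rewrite (Abar_gram b) eq_sym (negbTE kk') mul0r mulr0.
  - by rewrite Cbar_gram eq_sym (negbTE kk') mulr0.
  rewrite (Abar_gram b) Cbar_gram eqxx/= exprMn -exprM /b [(beta _ * 2)%N]mulnC.
  (* At the head of a block [beta 0 = 0], so the required weight is 1 and comes from C^T C;
     elsewhere J^T D_b J supplies it twice. *)
  case: (pos k) => [|j]/=; first by rewrite /beta !muln0 expr0; lra.
  rewrite mul1r mulr0 add0r.
  have : 0 <= eta ^+ (2 * beta j.+1) * (v k 0) ^+ 2.
    by rewrite mulr_ge0 ?sqr_ge0// exprn_ge0// ltW.
  by set x := eta ^+ _; rewrite expr2; lra.
(* Each summand of [E] gains its factor eta from one property of the exponents: D_a A from [alpha]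
   exceeding the midpoint, D_b J A from the strict concavity of [beta], and J^T D_b F from its
   strict growth together with the triangularity of [F]. *)
have Ebound : `|dotp v (E *m v)| <=
    c * eta * n%:R * \sum_k (eta ^+ beta (pos k) * v k 0) ^+ 2.
  apply: quad_weighted_bound => [|k k']; first by rewrite mulr_ge0; lra.
  have -> : c * eta * `|eta ^+ beta (pos k) * eta ^+ beta (pos k')|
     = (K + 1) * eta * `|eta ^+ beta (pos k) * eta ^+ beta (pos k')|
     + n%:R * ((K + 1) * eta * `|eta ^+ beta (pos k) * eta ^+ beta (pos k')|)
     + n%:R * ((K + 1) * eta * `|eta ^+ beta (pos k) * eta ^+ beta (pos k')|).
    by rewrite /c; ring.
  set w := _ * _ * `|_|.
  have w0 : 0 <= w by rewrite !mulr_ge0// ltW.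
  have sum_n (f : 'I_n -> R) : (forall j, `|f j| <= w) -> `|\sum_j f j| <= n%:R * w.
    move=> fw; apply: le_trans (ler_norm_sum _ _ _) _.
    by apply: le_trans (ler_sum _ (fun j _ => fw j)) _; rewrite sumr_const card_ord mulr_natl.
  have w_bound x m : `|x| <= K + 1 -> (beta (pos k) + beta (pos k') + 1 <= m)%N ->
      `|eta ^+ m * x| <= w by exact: weight_bound.
  rewrite mxE [X in `|X + _|]mxE.
  apply: le_trans (ler_normD _ _) _; rewrite [X in _ + `|X| <= _]mxE normrN; apply: lerD; last first.
    rewrite mxE; apply: sum_n => j; rewrite mul_mx_diag mxE [X in _ * X * _]mxE.
    rewrite [X in X * _ * _]mxE.
    have [->|/Abar_neq0[_ pk]] := eqVneq (J j k) 0; first by rewrite !mul0r normr0.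
    have [->|/Fpos pk'] := eqVneq (F j k') 0; first by rewrite mulr0 normr0.
    rewrite [J j k * _]mulrC -mulrA; apply: w_bound.
      rewrite normrM -[K + 1]mul1r ler_pM ?Abar_norm//.
      by rewrite (le_trans (FK _ _))// lerDl.
    have := beta_le pk' (ltnW (ltnW (ltnW (posN j)))).
    by have := beta_lt (ltnW (ltnW (posN j))); rewrite pk; lia.
  apply: le_trans (ler_normD _ _) _; rewrite [X in _ + `|X| <= _]mxE normrN; apply: lerD; last first.
    rewrite mxE; apply: sum_n => j; rewrite mul_diag_mx mxE [X in X * _ * _]mxE.
    have [->|/Abar_neq0[_ pj]] := eqVneq (J k j) 0.
      by rewrite mulr0 mul0r normr0.
    have [->|/A0 pk'] := eqVneq (A j k') 0; first by rewrite mulr0 normr0.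
    rewrite -mulrA; apply: w_bound.
      by rewrite normrM -[K + 1]mul1r ler_pM ?Abar_norm.
    rewrite pj in pk'; have := beta_le pk' (ltnW (posN k)).
    by have := beta_concave (ltnW (posN k)); lia.
  rewrite mul_diag_mx mxE [X in X * _]mxE.
  have [->|/A0 pk'] := eqVneq (A k k') 0; first by rewrite mulr0 normr0.
  apply: w_bound => //.
  have := beta_le pk' (ltnW (ltnW (posN k))); have := alphaE (pos k); lia.
rewrite -/A SAE dotpBr; move: DbE Ebound (hd v).
rewrite -[C^T *m C *m v]mulmxA [dotp v (C^T *m _)]dotpC dotp_mulmxl trmxK.
set s := \sum_k _ => h1 h2 h3.
have s0 : 0 <= s by apply: sumr_ge0 => k _; rewrite sqr_ge0.
have := ler_norm (dotp v (E *m v)).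
have := ler_wpM2r s0 cne.
lra.
Qed.

End ObservabilityLyapunov.

(** * The barrier principle *)

Section RealFunctions.
Context {R : realType}.
Implicit Types (g : R -> R) (t : R).

Lemma is_derive_continuous g t dg : is_derive t 1 g dg -> {for t, continuous g}.
Proof.
by move=> [/derivable1_diffP dgt _]; exact: differentiable_continuous.
Qed.

Lemma continuous_eps g t : {for t, continuous g} ->
  forall e, 0 < e -> exists2 d, 0 < d & forall s, `|s - t| < d -> `|g s - g t| < e.
Proof.
move=> /cvgrPdist_lt gt e e0; have [d /= d0 hd] := gt e e0.
by exists d => // s st; rewrite distrC; apply: hd; rewrite /= distrC.
Qed.

Lemma cvg_right_eps g t : g @ t^'+ --> g t ->
  forall e, 0 < e -> exists2 d, 0 < d & forall s, t <= s < t + d -> `|g s - g t| < e.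
Proof.
move=> /cvgrPdist_lt gt e e0; have [d /= d0 hd] := gt e e0.
exists d => // s /andP[]; rewrite le_eqVlt => /orP[/eqP <-|ts] st.
  by rewrite subrr normr0.
rewrite distrC; apply: hd => //=; rewrite ltr_norml; apply/andP; split; lra.
Qed.

Lemma is_derive_gt0_left g t dg : is_derive t 1 g dg -> 0 < dg ->
  exists2 d, 0 < d & forall s, t - d < s < t -> g s < g t.
Proof.
move=> [dgt dgE] dg0; move: dgt; rewrite /derivable => dgt.
have : (fun h => h^-1 *: ((g \o shift t) (h *: 1) - g t)) @ 0^' --> dg.
  by rewrite -dgE; exact: dgt.
move=> /cvgrPdist_lt /(_ dg dg0)[d /= d0 hd].
exists d => // s /andP[ds st].
have st0 : s - t < 0 by rewrite subr_lt0.
have := hd (s - t); rewrite /= sub0r normrN ltr0_norm// => /(_ _ _).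
have -> : (s - t) *: (1 : R) + t = s by rewrite [X in X + _]mulr1 subrK.
have -> : (s - t)^-1 *: (g s - g t) = (g s - g t) / (s - t) by rewrite [LHS]mulrC.
have ds' : - (s - t) < d by lra.
move=> /(_ ds' (ltr0_neq0 st0)) h.
have q0 : 0 < (g s - g t) / (s - t) by move: h; rewrite ltr_norml => /andP[]; lra.
rewrite -subr_lt0 -[g s - g t](divfK (ltr0_neq0 st0)).
by rewrite pmulr_rlt0.
Qed.

Lemma is_derive_quad n (D : R -> 'M[R]_n) (D' : 'M[R]_n) t (v : 'cV[R]_n) :
  (forall i j, is_derive t 1 (fun s => D s i j) (D' i j)) ->
  is_derive t 1 (fun s => dotp v (D s *m v)) (dotp v (D' *m v)).
Proof.
move=> hD; rewrite dotp_quad_sumE.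
have -> : (fun s => dotp v (D s *m v))
        = \sum_i \sum_j ((v i 0 * v j 0) *: (fun s => D s i j)).
  apply/funext => s; rewrite dotp_quad_sumE fct_sumE; apply: eq_bigr => i _.
  by rewrite fct_sumE; apply: eq_bigr => j _.
by apply: is_derive_sum => i; apply: is_derive_sum => j; exact: is_deriveZ.
Qed.

End RealFunctions.

Section Barrier.
Context {R : realType} {n : nat}.

Lemma posdef_perturb (B : 'M[R]_n) : posdef B -> exists2 e, 0 < e &
  forall B' : 'M[R]_n, B'^T = B' -> (forall i j, `|B' i j - B i j| <= e) -> posdef B'.
Proof.
move=> pB; have [c c0 hc] := posdef_coercive pB.
have n0 : 0 <= n%:R :> R by rewrite ler0n.
have n1 : 0 < n%:R + 1 :> R by lra.
(* Dividing by n + 1 rather than n makes the final comparison strict and covers n = 0. *)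
exists (c / (n%:R + 1)) => [|B' symB' hB']; first by rewrite divr_gt0.
apply/posdefP; split=> // v v0; have vv := dotp_gt0 v0.
have h : `|dotp v ((B' - B) *m v)| <= c / (n%:R + 1) * n%:R * dotp v v.
  apply: quad_bound => [|i j]; first exact/ltW/divr_gt0.
  by rewrite 2!mxE hB'.
have : c / (n%:R + 1) * n%:R * dotp v v < c * dotp v v.
  by rewrite ltr_pM2r// mulrAC ltr_pdivrMr// ltr_pM2l// ltrDl.
move: h (hc v); rewrite mulmxBl dotpBr; set x := dotp v (B' *m v).
by move=> /ler_normlP[h _] h1 h2; lra.
Qed.

(* At the first time where D stops being positive definite it is still
   positive semidefinite, with some v in its kernel along which the quadratic
   form is increasing: it was therefore negative just before. *)
Lemma posdef_barrier (D D' : R -> 'M[R]_n) :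
  (forall t, 0 <= t -> (D t)^T = D t) ->
  (forall t : R, 0 < t -> forall i j, is_derive t 1 (fun s => D s i j) (D' t i j)) ->
  (forall i j, (fun s => D s i j) @ (0 : R)^'+ --> D 0 i j) ->
  posdef (D 0) ->
  (forall t, 0 < t -> psd (D t) -> forall v, v != 0 -> D t *m v = 0 ->
     0 < dotp v (D' t *m v)) ->
  forall t, 0 <= t -> posdef (D t).
Proof.
move=> symD dD D0 pD0 touch.
have dcont (t : R) : 0 < t -> forall i j, {for t, continuous (fun s => D s i j)}.
  by move=> t0 i j; exact: is_derive_continuous (dD t t0 i j).
have rcont (t : R) : 0 <= t -> forall i j, (fun s => D s i j) @ t^'+ --> D t i j.
  rewrite le_eqVlt => /predU1P[<-//|t0] i j.
  by apply: cvg_at_right_filter; exact: dcont.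
have openD t : 0 <= t -> posdef (D t) ->
    exists2 d, 0 < d & forall s, t <= s < t + d -> posdef (D s).
  move=> t0 /posdef_perturb[e e0 he].
  have [d hd] : {d : 'I_n * 'I_n -> R & forall k, 0 < d k /\
      forall s, t <= s < t + d k -> `|D s k.1 k.2 - D t k.1 k.2| < e}.
    apply: (@choice _ _ (fun k x => 0 < x /\ forall s, t <= s < t + x ->
      `|D s k.1 k.2 - D t k.1 k.2| < e)) => k.
    by have [x x0 hx] := cvg_right_eps (rcont t t0 k.1 k.2) e0; exists x.
  exists (\big[Num.min/1]_k d k) => [|s /andP[ts st]].
    by apply: lt_bigmin => // k _; case: (hd k).
  apply: he => [|i j]; first by rewrite symD// (le_trans t0).
  apply/ltW/(hd (i, j)).2; rewrite ts/=; apply: lt_le_trans st _.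
  by rewrite lerD2l bigmin_le_cond.
move=> t1 t10; apply: contrapT => nD1.
pose E := [set T : R | 0 <= T /\ forall s, 0 <= s <= T -> posdef (D s)].
have E0 : E 0.
  by split=> // s; rewrite -eq_le => /eqP <-.
have Et1 T : E T -> T <= t1.
  by move=> [T0 hT]; rewrite leNgt; apply/negP => /ltW t1T; apply: nD1; apply: hT; rewrite t10.
have supE : has_sup E by split; [exists 0|exists t1].
set T := sup E.
have T0 : 0 <= T by exact: sup_upper_bound.
have below s : 0 <= s -> s < T -> posdef (D s).
  move=> s0 sT; have [|T' [_ hT'] sT'] := @sup_adherent _ E (T - s) _ supE.
    by rewrite subr_gt0.
  by apply: hT'; rewrite s0/= ltW//; rewrite -/T in sT'; lra.
(* If [D T] is positive definite, openness extends the interval beyond its supremum, a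
   contradiction. Only the time [T] itself remains to be examined. *)
suff /(openD T T0)[d d0 hd] : posdef (D T).
  have : E (T + d / 2).
    split=> [|s /andP[s0 sT]]; first by rewrite addr_ge0// divr_ge0// ltW.
    have [?|Ts] := ltP s T; first exact: below.
    by apply: hd; rewrite Ts/=; lra.
  by move/(sup_upper_bound supE); rewrite -/T; lra.
have [<-//|TN0] := eqVneq 0 T.
have Tp : 0 < T by rewrite lt_neqAle TN0.
have dq v := is_derive_quad v (dD T Tp).
have psdT : psd (D T).
  move=> v; rewrite leNgt; apply/negP => vDv.
  have := @continuous_eps _ _ _ (is_derive_continuous (dq v)) (- dotp v (D T *m v)).
  rewrite oppr_gt0 => /(_ vDv)[d d0 hd].
  pose s := Num.max 0 (T - d / 2).
  have s0 : 0 <= s by rewrite le_max lexx.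
  have sT : s < T by rewrite gt_max Tp; lra.
  have : `|s - T| < d.
    have : T - d / 2 <= s by rewrite le_max lexx orbT.
    by rewrite ltr_norml => ?; apply/andP; split; lra.
  move=> /hd; rewrite ltr_norml => /andP[_].
  by have := posdef_psd (below s s0 sT) v; lra.
apply/posdefP; split; first exact: symD.
move=> v v0; rewrite lt_neqAle psdT andbT eq_sym; apply/negP => /eqP vDv.
have Dv := psd_null (symD T T0) psdT vDv.
have [d d0 hd] := is_derive_gt0_left (dq v) (touch T Tp psdT v v0 Dv).
pose s := Num.max 0 (T - d / 2).
have s0 : 0 <= s by rewrite le_max lexx.
have sT : s < T by rewrite gt_max Tp; lra.
have sd : T - d / 2 <= s by rewrite le_max lexx orbT.
have := hd s; rewrite sT andbT vDv => /(_ _).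
have -> : T - d < s by lra.
by move=> /(_ isT); rewrite ltNge (posdef_psd (below s s0 sT)).
Qed.

End Barrier.

(** * The Riccati equation *)

Section Gronwall.
Context {R : realType}.

Lemma within_continuous_right (g dg : R -> R) (T : R) : 0 < T ->
  (forall t : R, 0 < t -> is_derive t 1 g (dg t)) -> g @ (0 : R)^'+ --> g 0 ->
  {within `[0, T], continuous g}.
Proof.
move=> T0 hg g0.
have cont t : 0 < t -> {for t, continuous g}.
  by move=> t0; exact: is_derive_continuous (hg t t0).
apply/continuous_within_itvP => //; split=> //.
  by move=> t; rewrite in_itv/= => /andP[t0 _]; exact: cont.
by apply: cvg_at_left_filter; exact: cont.
Qed.

Lemma is_derive_expRM (c t : R) :
  is_derive t 1 (fun s : R => expR (c * s)) (c * expR (c * t)).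
Proof.
have h : is_derive t 1 (fun s : R => c * s) c.
  have -> : (fun s : R => c * s) = c *: id by [].
  by apply: is_derive_eq; rewrite [LHS]mulr1.
by rewrite mulrC; apply: (@is_derive1_comp _ expR (fun s => c * s)).
Qed.

Lemma gronwall_le0 (g dg : R -> R) (kappa T : R) : 0 < T ->
  (forall t : R, 0 < t -> is_derive t 1 g (dg t)) -> g @ (0 : R)^'+ --> g 0 ->
  (forall t, 0 < t < T -> dg t <= kappa * g t) -> g 0 <= 0 -> g T <= 0.
Proof.
move=> T0 hg gc hk g0.
pose psi (s : R) := g s * expR (- kappa * s).
have dpsi (t : R) : 0 < t ->
    is_derive t 1 psi ((dg t - kappa * g t) * expR (- kappa * t)).
  move=> t0; have h1 := hg t t0; have h2 := is_derive_expRM (- kappa) t.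
  have := @is_deriveM _ _ g (fun s => expR (- kappa * s)) t 1 _ _ h1 h2.
  move=> h; apply: is_derive_eq.
  by rewrite /GRing.scale/=; ring.
have psi0 : psi @ (0 : R)^'+ --> psi 0.
  apply: cvgM => //; apply: cvg_at_right_filter.
  exact: is_derive_continuous (is_derive_expRM (- kappa) 0).
have psic := within_continuous_right T0 dpsi psi0.
have dpsi' t : t \in `]0, T[%R ->
    is_derive t 1 psi ((dg t - kappa * g t) * expR (- kappa * t)).
  by rewrite in_itv/= => /andP[t0 _]; exact: dpsi.
have [c] := MVT T0 dpsi' psic; rewrite in_itv/= => /andP[c0 cT] h.
have : psi T <= 0.
  have : psi 0 <= 0 by rewrite /psi mulr0 expR0 mulr1.
  suff : psi T - psi 0 <= 0 by lra.
  rewrite h subr0 pmulr_lle0// pmulr_lle0 ?expR_gt0// subr_le0.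
  by apply: hk; rewrite c0.
by rewrite /psi pmulr_lle0 // expR_gt0.
Qed.

End Gronwall.

Section Riccati.
Context {R : realType} {n q : nat}.
Implicit Types (A P : R -> 'M[R]_n) (Gamma : 'M[R]_n) (C : 'M[R]_(q, n)).

Definition riccati_rhs (A P Gamma : 'M[R]_n) C : 'M[R]_n :=
  A *m P + P *m A^T + Gamma - P *m C^T *m C *m P.

(** Derivatives are taken at positive times only, with a one-sided limit at 0, because the values at
    negative times carry no meaning. *)
Definition riccati_solution A P Gamma C :=
  (forall t : R, 0 < t -> forall i j,
     is_derive t 1 (fun s => P s i j) (riccati_rhs (A t) (P t) Gamma C i j)) /\
  (forall i j, (fun s => P s i j) @ (0 : R)^'+ --> P 0 i j).

(** This bound depends on the solution and on [T]; it only feeds the Gronwall constant in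
    [riccati_sym]. The uniform bound is [riccati_bounded]. *)
Lemma riccati_entries_bounded A P Gamma C T : 0 < T ->
  riccati_solution A P Gamma C ->
  exists2 b, 0 <= b & forall t, 0 <= t <= T -> forall i j, `|P t i j| <= b.
Proof.
move=> T0 [dP P0].
have [b hb] : {b : 'I_n * 'I_n -> R & forall k t, 0 <= t <= T -> `|P t k.1 k.2| <= b k}.
  apply: (@choice _ _ (fun k x => forall t, 0 <= t <= T -> `|P t k.1 k.2| <= x)) => k.
  have c := within_continuous_right T0 (fun t t0 => dP t t0 k.1 k.2) (P0 k.1 k.2).
  have c' : {within `[0, T], continuous (fun t => `|P t k.1 k.2|)}.
    by move=> t; apply: (continuous_comp (c t)); exact: norm_continuous.
  have [x _ hx] := EVT_max (ltW T0) c'.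
  by exists `|P x k.1 k.2| => t tT; apply: hx; rewrite in_itv.
exists (\sum_k `|b k|) => [|t tT i j]; first by apply: sumr_ge0.
apply: le_trans (hb (i, j) t tT) _; apply: le_trans (ler_norm _) _.
by rewrite (bigD1 (i, j))//= lerDl; apply: sumr_ge0.
Qed.

(** P - P^T solves a linear homogeneous equation and starts at 0, so Gronwall's inequality for its
    squared Frobenius norm keeps it at 0. *)
Lemma riccati_sym A P Gamma C K :
  riccati_solution A P Gamma C -> 0 <= K ->
  (forall t : R, 0 < t -> forall i j, `|A t i j| <= K) ->
  Gamma^T = Gamma -> (P 0)^T = P 0 ->
  forall t, 0 <= t -> (P t)^T = P t.
Proof.
move=> solP K0 AK symG symP0 T; rewrite le_eqVlt => /predU1P[<-//|T0].
have [b b0 hb] := riccati_entries_bounded T0 solP.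
have [dP P0] := solP.
have [h h0 hH] := entry_bounded (C^T *m C).
pose E t := P t - (P t)^T.
(* With P^T rather than P in [N], the mixed terms P^T H P of N E and E N^T cancel, where H = C^T C,
   and the difference of the two quadratic terms remains. *)
pose N t := A t - (P t)^T *m (C^T *m C).
pose nu := K + n%:R * (b * h).
have nu0 : 0 <= nu by rewrite addr_ge0// !mulr_ge0.
have Nnu t : 0 < t < T -> forall i j, `|N t i j| <= nu.
  move=> /andP[t0 tT] i j; rewrite !mxE; apply: le_trans (ler_normB _ _) _.
  apply: lerD; first exact: AK.
  apply: le_trans (ler_norm_sum _ _ _) _.
  apply: (@le_trans _ _ (\sum_(k < n) (b * h))).
    apply: ler_sum => k _; rewrite normrM mxE ler_pM//.
    by apply: hb; rewrite !ltW.
  by rewrite sumr_const card_ord mulr_natl.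
pose E' t := N t *m E t + E t *m (N t)^T.
have dE (t : R) : 0 < t -> forall i j, is_derive t 1 (fun s => E s i j) (E' t i j).
  move=> t0 i j.
  have -> : (fun s => E s i j) = (fun s => P s i j) - (fun s => P s j i).
    by apply/funext => s; rewrite !mxE.
  have -> : E' t i j = riccati_rhs (A t) (P t) Gamma C i j
                     - riccati_rhs (A t) (P t) Gamma C j i.
    suff -> : E' t = riccati_rhs (A t) (P t) Gamma C
                   - (riccati_rhs (A t) (P t) Gamma C)^T.
      by rewrite mxE [X in _ + X = _]mxE [X in _ - X = _]mxE.
    rewrite /E' /N /E /riccati_rhs !raddfB/= !raddfD/= !trmx_mul !trmxK symG.
    rewrite !(mulmxDl, mulmxDr, mulmxBl, mulmxBr, mulNmx, mulmxN) ?trmx_mul ?trmxK !mulmxA.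
    set x1 := A t *m P t; set x2 := P t *m (A t)^T; set x3 := A t *m (P t)^T.
    set x4 := (P t)^T *m (A t)^T; set x5 := P t *m C^T *m C *m P t.
    set x6 := (P t)^T *m C^T *m C *m P t; set x7 := (P t)^T *m C^T *m C *m (P t)^T.
    by clearbody x1 x2 x3 x4 x5 x6 x7; apply/matrixP => i' j'; rewrite !mxE; ring.
  by apply: is_deriveB; exact: dP.
have Esym t i j : E t i j = - E t j i by rewrite !mxE opprB.
pose phi t := \sum_i \sum_j (E t i j) ^+ 2.
pose dphi t := \sum_i \sum_j (2 * (E t i j * E' t i j)).
have dphiP (t : R) : 0 < t -> is_derive t 1 phi (dphi t).
  move=> t0; have -> : phi = \sum_i \sum_j (fun s => E s i j) ^+ 2.
    apply/funext => s; rewrite fct_sumE; apply: eq_bigr => i _.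
    by rewrite fct_sumE; apply: eq_bigr => j _.
  apply: is_derive_sum => i; apply: is_derive_sum => j.
  have h1 := dE t t0 i j; apply: is_derive_eq.
  by rewrite expr1 mulrA.
(* As E is antisymmetric, E N^T = - (N E)^T, and the derivative of [phi] becomes 4 tr(E^T N E): a
   sum over the columns of E of the quadratic form of [N]. *)
have dphi_le t : 0 < t < T -> dphi t <= 4 * (nu * n%:R) * phi t.
  move=> tT; pose NE := N t *m E t.
  have -> : dphi t = 4 * \sum_i \sum_j E t i j * NE i j.
    have E'E i j : E' t i j = NE i j - NE j i.
      rewrite /E' mxE; congr (_ + _).
      have -> : E t *m (N t)^T = - NE^T.
        rewrite /NE trmx_mul -mulNmx; congr (_ *m _).
        by apply/matrixP => i' j'; rewrite Esym [RHS]mxE [in RHS]mxE.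
      by rewrite !mxE.
    have swap : \sum_i \sum_j E t i j * NE j i = - \sum_i \sum_j E t i j * NE i j.
      rewrite exchange_big/= -sumrN; apply: eq_bigr => i _.
      by rewrite -sumrN; apply: eq_bigr => j _; rewrite Esym mulNr.
    transitivity (2 * (\sum_i \sum_j E t i j * NE i j - \sum_i \sum_j E t i j * NE j i)).
      rewrite -sumrB mulr_sumr; apply: eq_bigr => i _.
      rewrite -sumrB mulr_sumr; apply: eq_bigr => j _.
      by rewrite E'E mulrBr.
    by rewrite swap; ring.
  rewrite -mulrA ler_pM2l//.
  rewrite exchange_big/= /phi [X in _ <= _ * X]exchange_big/= mulr_sumr.
  apply: ler_sum => j _.
  have := quad_bound (col j (E t)) nu0 (Nnu t tT).
  move/(le_trans (ler_norm _)).
  rewrite !dotpE; congr (_ <= _ * _); apply: eq_bigr => i _.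
    by rewrite mxE; congr (_ * _); rewrite !mxE; apply: eq_bigr => k _; rewrite [X in _ * X]mxE.
  by rewrite mxE expr2.
have phi0 : phi @ (0 : R)^'+ --> phi 0.
  apply: cvg_big => [|i _]; first exact: add_continuous.
  apply: cvg_big => [|j _]; first exact: add_continuous.
  apply: (@continuous_cvg _ _ _ _ _ (fun s => E s i j) (fun x => x ^+ 2)).
    exact: exprn_continuous.
  have -> : (fun s => E s i j) = (fun s => P s i j) - (fun s => P s j i).
    by apply/funext => s; rewrite !mxE.
  have -> : E 0 i j = P 0 i j - P 0 j i by rewrite !mxE.
  by apply: cvgB.
have : phi T <= 0.
  apply: (gronwall_le0 T0 dphiP phi0 dphi_le).
  rewrite /phi big1// => i _; rewrite big1// => j _.
  by rewrite /E symP0 subrr mxE expr0n.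
move=> phiT; apply/esym/eqP; rewrite -subr_eq0; apply/eqP/matrixP => i j.
rewrite [RHS]mxE; apply/eqP; rewrite -sqrf_eq0 eq_le sqr_ge0 andbT.
apply: le_trans phiT; rewrite /phi (bigD1 i)//= (bigD1 j)//= -addrA lerDl.
rewrite addr_ge0//; first by apply: sumr_ge0 => k _; exact: sqr_ge0.
by apply: sumr_ge0 => k _; apply: sumr_ge0 => m _; exact: sqr_ge0.
Qed.

(* W - P is a barrier for W = (eps S)^-1: where it degenerates, P v = W v and
   w = W v gives v = eps S w, so that the Lyapunov inequality applies to w. *)
Lemma riccati_bounded (S P0 Gamma : 'M[R]_n) C (delta : R) :
  posdef S -> 0 < delta -> P0^T = P0 ->
  exists2 M, 0 < M & forall A P,
    riccati_solution A P Gamma C -> P 0 = P0 ->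
    (forall t, 0 <= t -> (P t)^T = P t) ->
    (forall t, 0 < t -> forall v, delta * dotp v v <=
       dotp (C *m v) (C *m v) - 2 * dotp v (S *m (A t *m v))) ->
    forall t, 0 <= t -> forall v, dotp v (P t *m v) <= M * dotp v v.
Proof.
move=> pS delta0 symP0; have /posdefP[symS _] := pS; have uS := posdef_unitmx pS.
have [k k0 hk] := quad_bounded (S *m Gamma *m S).
have [k' k'0 hk'] := quad_bounded P0.
have pI := posdef_invmx pS; have [c c0 hc] := posdef_coercive pI.
(* The three bounds serve in turn to get eps |C w|^2 <= |C w|^2, so that the innovation term covers
   the one in the Lyapunov inequality; to absorb the [Gamma] term into half of [delta]; and to place
   [W] above [P0] at time 0. *)
pose eps := Num.min 1 (Num.min (delta / (2 * k)) (c / (2 * k'))).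
have eps0 : 0 < eps by rewrite !lt_min ltr01 !divr_gt0// mulr_gt0.
have eps1 : eps <= 1 by rewrite ge_min lexx.
have epsk : eps * k <= delta / 2.
  have : eps <= delta / (2 * k) by rewrite !ge_min lexx !orbT.
  by rewrite ler_pdivlMr ?mulr_gt0// => ?; lra.
have epsk' : k' <= eps^-1 * c / 2.
  have : eps <= c / (2 * k') by rewrite !ge_min lexx !orbT.
  rewrite ler_pdivlMr ?mulr_gt0// => h.
  by rewrite -mulrA mulrC ler_pdivlMr//; lra.
pose W := eps^-1 *: invmx S.
have symW : W^T = W by rewrite linearZ/=; have /posdefP[-> _] := pI.
have [M M0 hM] := quad_bounded W.
exists M => // A P [dP cP] P0E symP lyap.
suff pD t : 0 <= t -> posdef (W - P t).
  move=> t t0 v; apply: le_trans (hM v); rewrite -subr_ge0 -dotpBr -mulmxBl.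
  exact/posdef_psd/pD.
move: t; apply: (@posdef_barrier _ _ _ (fun t => - riccati_rhs (A t) (P t) Gamma C)).
- by move=> t t0; rewrite linearB/= symW symP.
- move=> t t0 i j.
  have -> : (fun s => (W - P s) i j) = cst (W i j) - (fun s => P s i j).
    by apply/funext => s; rewrite !mxE.
  rewrite [X in is_derive _ _ _ X]mxE -sub0r; by apply: is_deriveB; exact: dP.
- move=> i j.
  have -> : (fun s => (W - P s) i j) = cst (W i j) - (fun s => P s i j).
    by apply/funext => s; rewrite !mxE.
  have -> : (W - P 0) i j = W i j - P 0 i j by rewrite !mxE.
  by apply: cvgB; [exact: cvg_cst|exact: cP].
- apply/posdefP; split; first by rewrite linearB/= symW P0E symP0.
  move=> v v0; have vv := dotp_gt0 v0.
  rewrite mulmxBl dotpBr P0E -scalemxAl dotpZr subr_gt0.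
  apply: le_lt_trans (hk' v) _; apply: (@lt_le_trans _ _ (eps^-1 * c * dotp v v)).
    rewrite ltr_pM2r//; apply: le_lt_trans epsk' _.
    by rewrite ltr_pdivrMr// ltr_pMr ?mulr_gt0 ?invr_gt0// ltr1n.
  by rewrite -mulrA ler_pM2l ?invr_gt0.
move=> t t0 psdD v v0; rewrite mulmxBl => /eqP; rewrite subr_eq0 eq_sym => /eqP Pv.
pose w := P t *m v.
have vE : v = eps *: (S *m w).
  by rewrite /w Pv -scalemxAl -scalemxAr scalerA mulfV ?gt_eqF// scale1r mulmxA mulmxV// mul1mx.
have w0 : w != 0.
  by apply: contra_neq v0 => w0; rewrite vE w0 mulmx0 scaler0.
have ww := dotp_gt0 w0.
rewrite mulNmx dotpNr /riccati_rhs !(mulmxDl, mulmxBl, mulNmx) -!mulmxA -/w.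
rewrite !(dotpDr, dotpBr, dotpNr).
have -> : dotp v (P t *m ((A t)^T *m v)) = dotp v (A t *m w).
  by rewrite -(symP t (ltW t0)) -dotp_mulmxl -/w dotpC dotp_mulmxl trmxK.
have -> : dotp v (P t *m (C^T *m (C *m w))) = dotp (C *m w) (C *m w).
  by rewrite -{1}(symP t (ltW t0)) -dotp_mulmxl -/w -dotp_mulmxl.
have -> : dotp v (A t *m w) = eps * dotp w (S *m (A t *m w)).
  by rewrite {1}vE dotpZl dotp_mulmxl symS.
have -> : dotp v (Gamma *m v) = eps ^+ 2 * dotp w (S *m Gamma *m S *m w).
  by rewrite vE -scalemxAr dotpZl dotpZr dotp_mulmxl symS !mulmxA; ring.
have h1 := lyap t t0 w; have h2 := hk w; have h3 := dotp_ge0 (C *m w).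
move: h1 h2 h3; set x := dotp w (S *m (A t *m w)); set y := dotp w (S *m Gamma *m S *m w).
set z := dotp (C *m w) _; set s := dotp w w in ww * => h1 h2 h3.
have h4 : eps * z <= z by exact: ler_piMl.
have h5 : eps * (delta * s) <= eps * (z - 2 * x) by rewrite ler_pM2l.
have h6 : eps * (eps * y) <= eps * (delta / 2 * s).
  rewrite ler_pM2l//; apply: (@le_trans _ _ (eps * (k * s))); first by rewrite ler_pM2l.
  by rewrite mulrA ler_pM2r.
have h7 : 0 < eps * (delta * s) by rewrite !mulr_gt0.
by rewrite expr2; lra.
Qed.

End Riccati.

(** * Exponential decay of the estimation error *)

Section ErrorDecay.
Context {R : realType} {n q : nat}.

(* The barrier P - mu e^(a t) e e^T replaces the Lyapunov function
   e^T P^-1 e: where it degenerates, P v = rho (v . e) e, so the terms in A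
   cancel, the innovation terms leave + (rho (v . e))^2 |C e|^2, and it remains
   to compare the quadratic remainder r with Gamma. *)
Lemma error_decay (P0 Gamma : 'M[R]_n) (C : 'M[R]_(q, n)) (M gamma Lambda : R) :
  posdef P0 -> 0 < M -> 0 < gamma ->
  (forall v, gamma * dotp v v <= dotp v (Gamma *m v)) ->
  exists eps K a : R, [/\ 0 < eps, 0 < a &
    forall (A P : R -> 'M[R]_n) (e r : R -> 'cV[R]_n),
    riccati_solution A P Gamma C -> P 0 = P0 ->
    (forall t, 0 <= t -> (P t)^T = P t) ->
    (forall t, 0 <= t -> forall v, dotp v (P t *m v) <= M * dotp v v) ->
    (forall t : R, 0 < t -> forall i, is_derive t 1 (fun s => e s i 0)
       (((A t - P t *m C^T *m C) *m e t + r t) i 0)) ->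
    (forall i, (fun s => e s i 0) @ (0 : R)^'+ --> e 0 i 0) ->
    (forall t, 0 < t -> dotp (r t) (r t) <= Lambda * dotp (e t) (e t) ^+ 2) ->
    dotp (e 0) (e 0) < eps ->
    forall t, 0 <= t -> dotp (e t) (e t) <= K * expR (- (a * t))].
Proof.
move=> pP0 M0 gamma0 hGamma; have [m m0 hm] := posdef_coercive pP0.
(* Budget at a touching point: [Gamma] yields gamma |v|^2, the growth rate [a] costs at most a
   quarter of it, and [mu] is so large that the remainder costs at most half. The absolute value and
   the added 1 keep [mu] positive for any [Lambda]. *)
pose a := gamma / (4 * M).
pose mu := 16 * M ^+ 3 * `|Lambda| / gamma ^+ 2 + 1.
have mu0 : 0 < mu.
  by rewrite ltr_wpDl// divr_ge0 ?sqr_ge0// mulr_ge0// mulr_ge0// exprn_ge0// ltW.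
have a0 : 0 < a by rewrite divr_gt0// mulr_gt0.
(* As P0 >= m I and e e^T <= |e|^2 I, the first value makes the barrier positive definite at time
   0. *)
exists (m / mu), (M / mu), a; split=> //; first exact: divr_gt0.
move=> A P e r [dP cP] P0E symP PM de ce hr e0.
pose rho t := mu * expR (a * t).
have rho0 t : 0 < rho t by rewrite mulr_gt0// expR_gt0.
pose D t := P t - rho t *: (e t *m (e t)^T).
pose e' t := (A t - P t *m C^T *m C) *m e t + r t.
pose D' t := riccati_rhs (A t) (P t) Gamma C - ((a * rho t) *: (e t *m (e t)^T)
   + rho t *: (e' t *m (e t)^T + e t *m (e' t)^T)).
have outerE (u w : 'cV[R]_n) i j : (u *m w^T) i j = u i 0 * w j 0.
  by rewrite mxE big_ord1 mxE.
have outer_quad (u w v : 'cV[R]_n) : dotp v (u *m w^T *m v) = dotp v u * dotp v w.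
  rewrite -mulmxA (_ : w^T *m v = (dotp w v)%:M).
    by rewrite mul_mx_scalar dotpZr mulrC (dotpC w).
  by apply/matrixP => i j; rewrite !ord1 [RHS]mxE eqxx mulr1n.
have DE i j : (fun s => D s i j) =
    (fun s => P s i j) - (fun s => rho s) * ((fun s => e s i 0) * (fun s => e s j 0)).
  by apply/funext => s; rewrite 3!mxE outerE.
have quadD t v : dotp v (D t *m v) = dotp v (P t *m v) - rho t * dotp v (e t) ^+ 2.
  by rewrite mulmxBl dotpBr -scalemxAl dotpZr outer_quad expr2.
have D'E t i j : D' t i j = riccati_rhs (A t) (P t) Gamma C i j
    - (a * rho t * (e t i 0 * e t j 0)
       + rho t * (e' t i 0 * e t j 0 + e t i 0 * e' t j 0)).
  rewrite /D'; set Q := riccati_rhs _ _ _ _; set w := e' t; clearbody Q w.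
  by rewrite !mxE !big_ord1 !mxE.
have drho (t : R) : is_derive t 1 rho (a * rho t).
  have h := is_derive_expRM a t.
  have -> : rho = mu *: (fun s : R => expR (a * s)) by [].
  rewrite (_ : a * rho t = mu *: (a * expR (a * t))); last by rewrite /rho mulrCA.
  exact: is_deriveZ.
have pD t : 0 <= t -> posdef (D t).
  move: t; apply: (@posdef_barrier _ _ D D').
  - by move=> t t0; rewrite linearB/= symP// linearZ/= trmx_mul trmxK.
  - move=> t t0 i j; rewrite DE.
    have h1 := dP t t0 i j; have h2 := drho t.
    have h3 := de t t0 i; have h4 := de t t0 j.
    apply: is_derive_eq.
    rewrite D'E -/(e' t) mulrfctE /GRing.scale/=; ring.
  - move=> i j; rewrite DE.
    have -> : D 0 i j = P 0 i j - rho 0 * (e 0 i 0 * e 0 j 0).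
      by rewrite 3!mxE outerE.
    apply: cvgB => //; apply: cvgM; last exact: cvgM.
    by apply: cvg_at_right_filter; exact: is_derive_continuous (drho 0).
  - apply/posdefP; split; first by rewrite linearB/= symP// linearZ/= trmx_mul trmxK.
    move=> v v0; rewrite quadD P0E subr_gt0 /rho mulr0 expR0 mulr1.
    have vv := dotp_gt0 v0; apply: lt_le_trans (hm v).
    apply: (@le_lt_trans _ _ (mu * (dotp v v * dotp (e 0) (e 0)))).
      by rewrite ler_pM2l// dotp_cauchy_schwarz.
    move: e0; rewrite ltr_pdivlMr// => e0.
    by rewrite mulrCA [X in _ < X]mulrC ltr_pM2l// mulrC.
  move=> t t0 psdD v v0 Dv.
  have vv := dotp_gt0 v0; have t0' := ltW t0.
  set s := dotp v (e t).
  have Pv : P t *m v = (rho t * s) *: e t.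
    apply/eqP; rewrite -subr_eq0 -Dv mulmxBl; apply/eqP; congr (_ - _).
    rewrite -scalemxAl -mulmxA -scalerA; congr (_ *: _).
    rewrite (_ : (e t)^T *m v = s%:M) ?mul_mx_scalar//.
    by apply/matrixP => i j; rewrite !ord1 [RHS]mxE eqxx mulr1n /s dotpC.
  have rs : rho t * s ^+ 2 <= M * dotp v v.
    have := PM t t0' v; rewrite Pv dotpZr -/s; lra.
  (* The final estimate is already available here, by testing [psdD] on [e t]. With rho >= mu it
     yields |e|^2 <= M / mu, which is the smallness that controls the remainder. *)
  have re : rho t * dotp (e t) (e t) <= M.
    have := psdD (e t); rewrite quadD; have := PM t t0' (e t).
    have [->|en0] := eqVneq (dotp (e t) (e t)) 0; first by move=> _ _; rewrite mulr0 ltW.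
    have ep : 0 < dotp (e t) (e t) by rewrite lt_neqAle eq_sym en0 dotp_ge0.
    move=> h1 h2; rewrite -(ler_pM2r ep) -mulrA -expr2; lra.
  have remainder : `|rho t * s * dotp v (r t)| <= gamma / 4 * dotp v v.
    set V := dotp v v in vv *; set x := dotp (e t) (e t) in re *.
    have x0 : 0 <= x by exact: dotp_ge0.
    have rM : 0 <= rho t * s ^+ 2 by rewrite mulr_ge0 ?sqr_ge0// ltW.
    have rx : 0 <= rho t * x by rewrite mulr_ge0// ltW.
    have xM : x <= M / mu.
      rewrite ler_pdivlMr// mulrC; apply: le_trans re; rewrite ler_wpM2r//.
      by rewrite ler_peMr ?(ltW mu0)// ltW// expR_gt1 mulr_gt0.
    have gV : 0 <= gamma / 4 * V by rewrite mulr_ge0 ?divr_ge0 ?(ltW vv) ?(ltW gamma0).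
    rewrite -ler_sqr ?nnegrE// real_normK ?num_real//.
    apply: (@le_trans _ _ ((rho t * s) ^+ 2 * (V * (`|Lambda| * x ^+ 2)))).
      rewrite exprMn ler_wpM2l ?sqr_ge0//.
      apply: le_trans (dotp_cauchy_schwarz _ _) _; rewrite ler_wpM2l ?(ltW vv)//.
      apply: le_trans (hr t t0) _; rewrite ler_wpM2r ?sqr_ge0//.
      exact: ler_norm.
    have -> : (rho t * s) ^+ 2 * (V * (`|Lambda| * x ^+ 2)) =
        (rho t * s ^+ 2) * (rho t * x) * x * (`|Lambda| * V) by ring.
    apply: (@le_trans _ _ (M * V * M * (M / mu) * (`|Lambda| * V))).
      rewrite ler_wpM2r ?mulr_ge0 ?(ltW vv)//.
      by apply: ler_pM => //; [exact: mulr_ge0|exact: ler_pM].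
    have -> : M * V * M * (M / mu) * (`|Lambda| * V) =
        M ^+ 3 * `|Lambda| / mu * V ^+ 2 by field; rewrite gt_eqF.
    have -> : (gamma / 4 * V) ^+ 2 = gamma ^+ 2 / 16 * V ^+ 2 by field.
    rewrite ler_wpM2r ?sqr_ge0// ler_pdivrMr//.
    have g2 : 0 < gamma ^+ 2 by rewrite exprn_gt0.
    have -> : gamma ^+ 2 / 16 * mu = M ^+ 3 * `|Lambda| + gamma ^+ 2 / 16.
      by rewrite /mu; field; rewrite gt_eqF.
    by lra.
  (* The innovation enters with coefficient -1 from the Riccati equation and +2 from the error
     equation, so a favourable +1 is left. *)
  have vD'v : dotp v (D' t *m v) = dotp v (Gamma *m v) - a * (rho t * s ^+ 2)
      + (rho t * s) ^+ 2 * dotp (C *m e t) (C *m e t) - 2 * (rho t * s * dotp v (r t)).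
    have Pvw (w : 'cV[R]_n) : dotp v (P t *m w) = rho t * s * dotp (e t) w.
      by rewrite -{1}(symP t t0') -dotp_mulmxl Pv dotpZl.
    have ve' : dotp v (e' t) = dotp v (A t *m e t)
        - rho t * s * dotp (C *m e t) (C *m e t) + dotp v (r t).
      by rewrite /e' dotpDr mulmxBl dotpBr -!mulmxA Pvw -dotp_mulmxl.
    have -> : dotp v (D' t *m v) = dotp v (riccati_rhs (A t) (P t) Gamma C *m v)
        - (a * rho t * s ^+ 2 + 2 * (rho t * s * dotp v (e' t))).
      rewrite /D'; set Q := riccati_rhs _ _ _ _; clearbody Q.
      rewrite mulmxBl dotpBr mulmxDl dotpDr -!scalemxAl !dotpZr mulmxDl dotpDr.
      by rewrite !outer_quad -/s; ring.
    rewrite ve' /riccati_rhs !(mulmxDl, mulmxBl, mulNmx) -!mulmxA.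
    rewrite !(dotpDr, dotpBr, dotpNr) !Pvw -!dotp_mulmxl Pv -!scalemxAr !dotpZr.
    by rewrite (dotpC _ v); ring.
  rewrite vD'v; have := hGamma v; have := dotp_ge0 (C *m e t).
  move=> /(mulr_ge0 (sqr_ge0 (rho t * s))).
  have : a * (rho t * s ^+ 2) <= gamma / 4 * dotp v v.
    apply: le_trans (ler_wpM2l (ltW a0) rs) _.
    by rewrite /a le_eqVlt; apply/orP; left; apply/eqP; field; rewrite gt_eqF.
  have := mulr_gt0 gamma0 vv; move: remainder => /ler_normlP[].
  lra.
move=> t t0; have := posdef_psd (pD t t0) (e t).
rewrite quadD; have := PM t t0 (e t); have := dotp_ge0 (e t).
set s := dotp _ _; move: (dotp (e t) _) => x s0 h1 h2.
have [->|sn0] := eqVneq s 0.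
  by rewrite mulr_ge0 ?expR_ge0// divr_ge0// ltW.
have sp : 0 < s by rewrite lt_neqAle eq_sym sn0.
have : rho t * s ^+ 2 <= M * s by lra.
rewrite expr2 mulrA ler_pM2r// /rho => h.
by rewrite expRN ler_pdivlMr ?expR_gt0// ler_pdivlMr//; lra.
Qed.
End ErrorDecay.

(** * Directional derivatives of C^2 maps *)

Section DirectionalDerivatives.
Context {R : realType} {V : normedModType R}.
Implicit Types (G : V -> R) (z v w : V).

Lemma is_derive_affine_line (W : normedModType R) (F : V -> W) z v (c : W) :
  (forall h : R, F (h *: v + z) = F z + h *: c) -> is_derive z v F c.
Proof.
move=> hF.
have q : (fun h : R => h^-1 *: ((F \o shift z) (h *: v) - F z)) @ 0^' --> c.
  apply: cvg_near_cst; near=> h.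
  have h0 : h != 0 by near: h; exact: nbhs_dnbhs_neq.
  by rewrite /= hF addrC addKr scalerA mulVf// scale1r.
by split; [apply/cvg_ex; exists c|exact: cvg_lim q].
Unshelve. all: by end_near. Qed.

Lemma derive_norm_le G z v (c : R) : derivable G z v ->
  (forall h : R, `|G (h *: v + z) - G z| <= c * `|h|) -> `|'D_v G z| <= c.
Proof.
move=> dG hc; rewrite leNgt; apply/negP => cD.
have e0 : 0 < `|'D_v G z| - c by rewrite subr_gt0.
have /cvgrPdist_lt /(_ _ e0)[d /= d0 hd] :
  (fun h : R => h^-1 *: ((G \o shift z) (h *: v) - G z)) @ 0^' --> 'D_v G z by exact: dG.
have d2 : 0 < d / 2 by rewrite divr_gt0.
have := hd (d / 2); rewrite /= sub0r normrN gtr0_norm// gt_eqF//.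
have -> : d / 2 < d by lra.
move=> /(_ isT isT) h1; have := hc (d / 2); rewrite (gtr0_norm d2) => h2.
move: h1; set q := _ *: _ => h1.
have qc : `|q| <= c.
  by rewrite /q normrZ normfV (gtr0_norm d2) mulrC ler_pdivrMr.
by have := lerB_dist ('D_v G z) q; lra.
Qed.

Lemma is_derive_line G z v (s : R) : derivable G (s *: v + z) v ->
  is_derive s 1 (fun h => G (h *: v + z)) ('D_v G (s *: v + z)).
Proof.
move=> dG.
have q : (fun h : R => h^-1 *: (((fun h => G (h *: v + z)) \o shift s) (h *: 1)
    - G (s *: v + z))) @ 0^' --> 'D_v G (s *: v + z).
  rewrite [X in X @ _](_ : _ = fun h : R =>
    h^-1 *: ((G \o shift (s *: v + z)) (h *: v) - G (s *: v + z))); first exact: dG.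
  by apply/funext => h /=; rewrite [X in X + s]mulr1 scalerDl addrA.
by split; [apply/cvg_ex; eexists; exact: q|exact: cvg_lim q].
Qed.

Lemma is_deriveZ_dir G z v (c : R) : derivable G z v ->
  is_derive z (c *: v) G (c * 'D_v G z).
Proof.
move=> dG.
have h1 : is_derive (c * 0) 1 (fun h => G (h *: v + z)) ('D_v G z).
  rewrite mulr0 -[in X in is_derive _ _ _ X](add0r z) -(scale0r v).
  by apply: is_derive_line; rewrite scale0r add0r.
have h2 : is_derive (0 : R) 1 (fun s : R => c * s) c.
  have -> : (fun s : R => c * s) = c *: id by [].
  by apply: is_derive_eq; rewrite [LHS]mulr1.
have [d e] := @is_derive1_comp _ (fun h => G (h *: v + z)) (fun s => c * s) 0 _ _ h1 h2.
have E : (fun h : R => h^-1 *: ((((fun h => G (h *: v + z)) \o (fun s => c * s)) \o shift 0) (h *: 1)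
   - ((fun h => G (h *: v + z)) \o (fun s => c * s)) 0))
   = (fun h : R => h^-1 *: ((G \o shift z) (h *: (c *: v)) - G z)).
  apply/funext => h /=; rewrite addr0 [h *: 1]mulr1 mulr0 scale0r add0r scalerA.
  by rewrite [c * h]mulrC.
by split; [move: d; rewrite /derivable E|move: e; rewrite /derive E mulrC].
Qed.

Lemma MVT_line G z v : (forall z', derivable G z' v) ->
  exists2 s : R, 0 <= s <= 1 & G (v + z) - G z = 'D_v G (s *: v + z).
Proof.
move=> dG.
have dg (s : R) : is_derive s 1 (fun h => G (h *: v + z)) ('D_v G (s *: v + z)).
  exact: is_derive_line.
have cg : {within `[0, 1], continuous (fun h => G (h *: v + z))}.
  by apply: continuous_subspaceT => s; exact: is_derive_continuous (dg s).
have [s] := @MVT_segment R (fun h => G (h *: v + z))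
  (fun s => 'D_v G (s *: v + z)) 0 1 ler01 (fun s _ => dg s) cg.
rewrite in_itv/= scale1r scale0r add0r subr0 mulr1 => s01 E.
by exists s.
Qed.

(* The C2 hypothesis only gives directional derivatives; this property of
   'D_w G, weaker than continuity on V, suffices for the additivity of 'D_v G
   in v, and holds for first derivatives without a Frechet derivative. *)
Definition plane_continuous G z v w := forall e : R, 0 < e ->
  exists2 d : R, 0 < d & forall a b : R, `|a| < d -> `|b| < d ->
    `|G (b *: w + (a *: v + z)) - G z| < e.

Lemma continuous_plane G z v w : {for z, continuous G} -> plane_continuous G z v w.
Proof.
move=> /cvgrPdist_lt cG e e0; have /nbhs_normP[d /= d0 hd] := cG e e0.
pose k := `|v| + `|w| + 1.
have k0 : 0 < k by rewrite ltr_wpDl// addr_ge0.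
exists (d / k) => [|a b ad bd]; first by rewrite divr_gt0.
rewrite distrC; apply: hd => /=.
have -> : z - (b *: w + (a *: v + z)) = - (b *: w + a *: v).
  by rewrite [X in - X]addrA opprD addrCA subrr addr0.
rewrite normrN; apply: le_lt_trans (ler_normD _ _) _; rewrite !normrZ.
apply: (@le_lt_trans _ _ (d / k * (`|v| + `|w|))).
  by rewrite mulrDr addrC lerD// ler_wpM2r// ltW.
by rewrite mulrAC ltr_pdivrMr// ltr_pM2l// /k ltrDl.
Qed.

(** The step along [v] is controlled by differentiability at [z]; the step along [w] by the mean
    value theorem, since plane continuity bounds ['D_w G] near [z]. *)
Lemma derivable_plane_continuous G z v w : (forall z', derivable G z' w) ->
  derivable G z v -> plane_continuous ('D_w G) z v w -> plane_continuous G z v w.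
Proof.
move=> dGw dGv cG e e0.
have e2 : 0 < e / 2 by rewrite divr_gt0.
have dv : is_derive (0 : R) 1 (fun h => G (h *: v + z)) ('D_v G (0 *: v + z)).
  by apply: is_derive_line; rewrite scale0r add0r.
have [d1 d10 hd1] := continuous_eps (is_derive_continuous dv) e2.
have [d2 d20 hd2] := cG 1 ltr01.
pose B := `|'D_w G z| + 1.
have B0 : 0 < B by rewrite ltr_wpDl.
exists (Num.min d1 (Num.min d2 (e / 2 / B))) => [|a b].
  by rewrite !lt_min d10 d20 divr_gt0.
rewrite !lt_min => /and3P[a1 a2 _] /and3P[_ b2 b3].
have h1 : `|G (a *: v + z) - G z| < e / 2.
  by have := hd1 a; rewrite subr0 scale0r add0r; exact.
have h2 : `|G (b *: w + (a *: v + z)) - G (a *: v + z)| <= `|b| * B.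
  have dGbw z' : derivable G z' (b *: w).
    by have [] := is_deriveZ_dir b (dGw z').
  have [s /andP[s0 s1] ->] := MVT_line (a *: v + z) dGbw.
  have [_ ->] := is_deriveZ_dir b (dGw (s *: (b *: w) + (a *: v + z))).
  rewrite normrM ler_wpM2l// scalerA.
  have sb : `|s * b| < d2.
    by rewrite normrM (ger0_norm s0); apply: le_lt_trans b2; rewrite ler_piMl.
  have := hd2 a (s * b) a2 sb.
  set x := 'D_w G _ => hx; have := lerB_dist x ('D_w G z); rewrite /B; lra.
have h3 : `|b| * B < e / 2 by rewrite -ltr_pdivlMr.
rewrite -(subrKA (G (a *: v + z))); apply: le_lt_trans (ler_normD _ _) _; lra.
Qed.

(** The increment is taken first along [v], then along [w]. The mean value theorem writes the second
    part as h times ['D_w G] at a nearby point of the plane, and plane continuity brings that point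
    back to [z]. *)
Lemma is_deriveD_dir G z v w :
  (forall z', derivable G z' w) -> derivable G z v ->
  plane_continuous ('D_w G) z v w ->
  is_derive z (v + w) G ('D_v G z + 'D_w G z).
Proof.
move=> dGw dGv cG.
have q : (fun h : R => h^-1 *: ((G \o shift z) (h *: (v + w)) - G z)) @ 0^'
    --> 'D_v G z + 'D_w G z.
  apply/cvgrPdist_lt => e e0; have e2 : 0 < e / 2 by rewrite divr_gt0.
  have /cvgrPdist_lt /(_ _ e2)[d1 /= d10 hd1] :
    (fun h : R => h^-1 *: ((G \o shift z) (h *: v) - G z)) @ 0^' --> 'D_v G z by exact: dGv.
  have [d2 d20 hd2] := cG _ e2.
  exists (Num.min d1 d2) => /=; first by rewrite lt_min d10 d20.
  move=> h; rewrite /= sub0r normrN lt_min => /andP[h1 h2] h0.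
  have := hd1 h; rewrite /= sub0r normrN => /(_ h1 h0) A1.
  have dGhw z' : derivable G z' (h *: w).
    by have [] := is_deriveZ_dir h (dGw z').
  have [s /andP[s0 s1]] := MVT_line (h *: v + z) dGhw.
  have [_ ->] := is_deriveZ_dir h (dGw (s *: (h *: w) + (h *: v + z))).
  rewrite scalerA => A2.
  have sh : `|s * h| < d2.
    by rewrite normrM (ger0_norm s0); apply: le_lt_trans h2; rewrite ler_piMl.
  have A3 := hd2 h (s * h) h2 sh.
  have -> : h *: (v + w) + z = h *: w + (h *: v + z).
    by rewrite scalerDr [X in X + z]addrC addrA.
  have -> : h^-1 *: (G (h *: w + (h *: v + z)) - G z) =
     h^-1 *: (G (h *: v + z) - G z) + 'D_w G ((s * h) *: w + (h *: v + z)).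
    rewrite -(subrKA (G (h *: v + z))) A2 scalerDr [LHS]addrC; congr (_ + _).
    by rewrite [LHS]mulrA mulVf// mul1r.
  move: A1 A3; set x := _ *: _; set y := 'D_w G (_ + _) => A1 A3.
  have -> : 'D_v G z + 'D_w G z - (x + y) = ('D_v G z - x) - (y - 'D_w G z) by ring.
  by apply: le_lt_trans (ler_normB _ _) _; lra.
by split; [apply/cvg_ex; eexists; exact: q|exact: cvg_lim q].
Qed.

Lemma derive_linear_dir G : (forall z v, derivable G z v) ->
  (forall z v w, plane_continuous ('D_w G) z v w) ->
  forall (n : nat) (c : 'I_n -> R) (vs : 'I_n -> V) z,
  'D_(\sum_i c i *: vs i) G z = \sum_i c i * 'D_(vs i) G z.
Proof.
move=> dG cG n c vs z.
elim/big_rec2: _ => [|i y x _ IH]; first exact: derive0.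
have d1 := is_deriveZ_dir (c i) (dG z (vs i)).
have d := is_deriveD_dir (dG^~ x) (dG z (c i *: vs i)) (cG z (c i *: vs i) x).
by rewrite (@derive_val _ _ _ _ _ _ _ d) IH (@derive_val _ _ _ _ _ _ _ d1).
Qed.

(** Two successive mean value theorems replace Taylor's formula: the factor 1/2 becomes an
    intermediate parameter in [0, 1], so the bound is [B] instead of B / 2. *)
Lemma taylor2_bound (F : V -> R) : C2 F ->
  forall (n : nat) (c : 'I_n -> R) (vs : 'I_n -> V) z (B : R),
  (forall s : R, 0 <= s <= 1 ->
    `|\sum_i \sum_j c i * c j *
       'D_(vs i) ('D_(vs j) F) (s *: (\sum_i c i *: vs i) + z)| <= B) ->
  `|F (\sum_i c i *: vs i + z) - F z - \sum_i c i * 'D_(vs i) F z| <= B.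
Proof.
move=> [dF [ddF cF]] n c vs z B hB.
set xi := \sum_i _ in hB *.
have cddF u z' v w : plane_continuous ('D_w ('D_u F)) z' v w.
  by apply: continuous_plane; exact: cF.
have cdF z' v w : plane_continuous ('D_w F) z' v w.
  by apply: derivable_plane_continuous.
have lin := derive_linear_dir (fun z v => dF v z) cdF.
have [s /andP[s0 s1] ->] := MVT_line z (dF xi).
rewrite -lin.
have dsxi z' : derivable ('D_xi F) z' (s *: xi).
  by have [] := is_deriveZ_dir s (ddF xi xi z').
have [s' /andP[s'0 s'1] ->] := MVT_line z dsxi.
have [_ ->] := is_deriveZ_dir s (ddF xi xi (s' *: (s *: xi) + z)).
have -> : 'D_xi F = \sum_j (c j *: 'D_(vs j) F).
  by apply/funext => z'; rewrite lin fct_sumE.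
set z1 := _ + z.
have dsum : is_derive z1 xi (\sum_j (c j *: 'D_(vs j) F))
    (\sum_j (c j *: 'D_xi ('D_(vs j) F) z1)).
  apply: is_derive_sum => j; apply: is_deriveZ.
  by split; first exact: ddF.
rewrite (@derive_val _ _ _ _ _ _ _ dsum).
have -> : \sum_j (c j *: 'D_xi ('D_(vs j) F) z1)
        = \sum_i \sum_j c i * c j * 'D_(vs i) ('D_(vs j) F) z1.
  rewrite exchange_big/=; apply: eq_bigr => j _.
  rewrite (derive_linear_dir (fun z v => ddF (vs j) v z) (cddF (vs j))).
  rewrite [LHS]mulr_sumr; apply: eq_bigr => i _.
  by rewrite mulrA [c j * _]mulrC.
rewrite normrM ger0_norm//; apply: le_trans (ler_piMl _ s1) _ => //.
rewrite /z1 scalerA; apply: hB; rewrite mulr_ge0//=.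
by rewrite -[1]mulr1 ler_pM.
Qed.

End DirectionalDerivatives.

(** * The observable form *)

Section C2Maps.
Context {R : realType} {V : normedModType R}.

Lemma derive_coord n (F : V -> 'cV[R]_n) (z v : V) k : derivable F z v ->
  'D_v (fun z => F z k 0) z = ('D_v F z) k 0.
Proof. by move=> dF; rewrite derive_mx// mxE. Qed.

Lemma derivable_coord n (F : V -> 'cV[R]_n) (z v : V) k : derivable F z v ->
  derivable (fun z => F z k 0) z v.
Proof. by move=> /derivable_mxP. Qed.

Lemma C2_coord n (F : V -> 'cV[R]_n) k : C2 F -> C2 (fun z => F z k 0).
Proof.
move=> [dF [ddF cF]].
have D1 v : 'D_v (fun z => F z k 0) = (fun z => ('D_v F z) k 0).
  by apply/funext => z; exact: derive_coord.
have D2 v w : 'D_w ('D_v (fun z => F z k 0)) = (fun z => ('D_w ('D_v F) z) k 0).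
  by apply/funext => z; rewrite D1; exact: derive_coord.
split; first by move=> v z; exact: derivable_coord.
split; first by move=> v w z; rewrite D1; exact: derivable_coord.
move=> v w z; rewrite D2.
apply: (@continuous_comp _ _ _ ('D_w ('D_v F)) (fun M : 'cV[R]_n => M k 0)).
  exact: cF.
exact: coord_continuous.
Qed.

(** Smoothness is assumed of the full right-hand side, the Lipschitz and second-derivative bounds of
    its nonlinear part. A linear map has constant directional derivatives, so both share their
    second derivatives. *)
Lemma C2_sub_linear (W : normedModType R) (l F : V -> W) :
  (forall (h : R) v z, l (h *: v + z) = l z + h *: l v) ->
  C2 (fun z => l z + F z) ->
  C2 F /\ forall v z, 'D_v (fun z => l z + F z) z = l v + 'D_v F z.
Proof.
move=> hl [df [ddf cf]]; set f := fun z => l z + F z in df ddf cf *.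
have dl v z : is_derive z v l (l v) by apply: is_derive_affine_line => h.
have dfP v z : is_derive z v f ('D_v f z) by split; first exact: df.
have FE : F = f - l by apply/funext => z; rewrite /f fctE addrAC subrr add0r.
have dF v z : is_derive z v F ('D_v f z - l v) by rewrite {1}FE; exact: is_deriveB.
have DF v : 'D_v F = 'D_v f - cst (l v).
  by apply/funext => z; rewrite (@derive_val _ _ _ _ _ _ _ (dF v z)).
have ddF v w z : is_derive z w ('D_v F) ('D_w ('D_v f) z).
  have h : is_derive z w ('D_v f) ('D_w ('D_v f) z) by split; first exact: ddf.
  by rewrite DF; apply: is_derive_eq; rewrite subr0.
split; last first.
  by move=> v z; rewrite (@derive_val _ _ _ _ _ _ _ (dF v z)) addrCA subrr addr0.
split; first by move=> v z; have [] := dF v z.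
split; first by move=> v w z; have [] := ddF v w z.
move=> v w; have -> : 'D_w ('D_v F) = 'D_w ('D_v f).
  by apply/funext => z; rewrite (@derive_val _ _ _ _ _ _ _ (ddF v w z)).
exact: cf.
Qed.

End C2Maps.

Section ObservableForm.
Context {R : realType} {p m : nat} {l : 'I_p -> nat}.
Local Notation n := (dimn l).
Variables (U : set 'cV[R]_m) (fbar : 'cV[R]_n * 'cV[R]_m -> 'cV[R]_n).
Variables (hbar : 'cV[R]_m -> 'cV[R]_p) (L : R).
Local Notation f := (fun z : 'cV[R]_n * 'cV[R]_m => Abar R l *m z.1 + fbar z).
Local Notation h := (fun z : 'cV[R]_n * 'cV[R]_m => Cbar R l *m z.1 + hbar z.2).

Lemma mulmx_ecol q (B : 'M[R]_(q, n)) i j : (B *m ecol R j) i 0 = B i j.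
Proof. by rewrite /ecol -colE mxE. Qed.

Lemma col_ecolE (e : 'cV[R]_n) : e = \sum_j e j 0 *: ecol R j.
Proof.
apply/matrixP => i k; rewrite ord1 summxE (bigD1 i)//= !mxE !eqxx mulr1 big1 ?addr0//.
by move=> j ji; rewrite !mxE eq_sym (negbTE ji) mulr0.
Qed.

Lemma jac_output x u : jac_x h x u = Cbar R l.
Proof.
apply/matrixP => i j; rewrite mxE.
have d : is_derive (x, u) (ecol R j, 0) h (Cbar R l *m ecol R j).
  apply: is_derive_affine_line => a /=.
  by rewrite scaler0 add0r mulmxDr -scalemxAr -addrA addrC.
by rewrite (@derive_val _ _ _ _ _ _ _ d) mulmx_ecol.
Qed.

Lemma fst_linear (a : R) (v z : 'cV[R]_n * 'cV[R]_m) :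
  Abar R l *m (a *: v + z).1 = Abar R l *m z.1 + a *: (Abar R l *m v.1).
Proof. by rewrite /= mulmxDr -scalemxAr addrC. Qed.

Hypothesis C2f : C2 f.

Lemma jac_dynamics x u : jac_x f x u = Abar R l + jac_x fbar x u.
Proof.
have [_ D] := C2_sub_linear fst_linear C2f.
by apply/matrixP => i j; rewrite !mxE D mxE mulmx_ecol mxE.
Qed.

Hypothesis lip : lipschitz_form U fbar L.

(** A move along [ecol R k'] changes [underline k] only when [pos k' <= pos k]. The Lipschitz
    condition therefore yields at once the size of the entries and the triangular pattern required
    by [observability_lyapunov]. *)
Lemma jac_fbar_bound x u k k' : U u ->
  `|jac_x fbar x u k k'| <= (if (pos k' <= pos k)%N then `|L| else 0).
Proof.
move=> Uu; have [[dfbar _] _] := C2_sub_linear fst_linear C2f.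
rewrite mxE -derive_coord//; apply: derive_norm_le; first exact: derivable_coord.
move=> a.
have -> : a *: (ecol R k', 0 : 'cV[R]_m) + (x, u) = (a *: ecol R k' + x, u).
  by congr (_, _); rewrite /= scaler0 add0r.
apply: le_trans (lip k _ _ Uu) _.
have -> : underline k (a *: ecol R k' + x) - underline k x =
    (if (pos k' <= pos k)%N then a else 0) *: ecol R k'.
  apply/matrixP => i j; rewrite ord1 !mxE.
  have [->|ik] := eqVneq i k'; last by rewrite !mulr0 add0r subrr.
  by case: ifP => _; rewrite ?mulr1 ?mul0r ?subr0// addrK.
apply: (@le_trans _ _ (`|L| * enorm ((if (pos k' <= pos k)%N then a else 0) *: ecol R k'))).
  by rewrite ler_wpM2r ?enorm_ge0// ler_norm.
have e1 : dotp (ecol R k') (ecol R k') = 1.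
  by rewrite dotpE (bigD1 k')//= big1 => [|i ik]; rewrite !mxE ?eqxx ?(negbTE ik) ?mulr1 ?mulr0 ?addr0.
rewrite enormE dotpZl dotpZr e1 mulr1 -expr2 sqrtr_sqr.
by case: ifP => _; rewrite ?normr0 ?mulr0 ?mul0r.
Qed.

Hypothesis d2 : bounded_d2 U fbar L.

(** The mean value theorem is scalar, so each coordinate is estimated separately by |L| |e|^2;
    summing the squares costs the factor n. *)
Lemma dynamics_remainder (x xi r : 'cV[R]_n) u : U u ->
  r = f (x, u) - f (xi, u) - jac_x f xi u *m (x - xi) ->
  dotp r r <= n%:R * L ^+ 2 * dotp (x - xi) (x - xi) ^+ 2.
Proof.
move=> Uu r_def; have [C2F _] := C2_sub_linear fst_linear C2f.
set e := x - xi.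
have rE k : r k 0 = fbar (x, u) k 0 - fbar (xi, u) k 0
   - \sum_j e j 0 * 'D_(ecol R j, 0) (fun z => fbar z k 0) (xi, u).
  rewrite r_def jac_dynamics mulmxDl /= -/e.
  have -> : Abar R l *m x + fbar (x, u) - (Abar R l *m xi + fbar (xi, u)) =
     Abar R l *m e + (fbar (x, u) - fbar (xi, u)).
    by rewrite /e mulmxBr opprD addrACA.
  rewrite opprD addrACA subrr add0r.
  have entry (a b c : 'cV[R]_n) : (a - b - c) k 0 = a k 0 - b k 0 - c k 0.
    by rewrite !mxE.
  rewrite entry; congr (_ - _).
  rewrite mxE; apply: eq_bigr => j _; rewrite mxE mulrC derive_coord//.
  by have [] := C2F.
have rk k : `|r k 0| <= `|L| * dotp e e.
  rewrite rE.
  have sumE : \sum_j e j 0 *: (ecol R j, 0 : 'cV[R]_m) = (e, 0).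
    rewrite {2}(col_ecolE e); elim/big_rec2: _ => // j y1 y2 _ ->.
    by congr (_, _); rewrite /= scaler0 addr0.
  have := @taylor2_bound R _ (fun z => fbar z k 0) (C2_coord k C2F) n
    (fun j => e j 0) (fun j => (ecol R j, 0)) (xi, u) (`|L| * dotp e e).
  rewrite sumE.
  have -> : (e, 0) + (xi, u) = (x, u) by rewrite /e; congr (_, _); rewrite ?subrK ?add0r.
  apply=> s _.
  have -> : s *: (e, 0 : 'cV[R]_m) + (xi, u) = (s *: e + xi, u).
    by congr (_, _); rewrite /= scaler0 add0r.
  have := d2 (s *: e + xi) e Uu; rewrite enorm_sqr => h2.
  have := coord_le_enorm (\sum_i \sum_j (e i 0 * e j 0) *: d2_x fbar i j (s *: e + xi) u) k.
  move/le_trans => /(_ _ h2) h3.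
  apply: (@le_trans _ _ (L * dotp e e)); last by rewrite ler_wpM2r ?dotp_ge0// ler_norm.
  apply: le_trans h3; rewrite summxE le_eqVlt; apply/orP; left; apply/eqP.
  congr (`|_|); apply: eq_bigr => i _; rewrite summxE; apply: eq_bigr => j _.
  rewrite [RHS]mxE; congr (_ * _); rewrite /d2_x.
  have [dF [ddF _]] := C2F.
  rewrite -derive_coord//; congr ('D_ _ _ _).
  by apply/funext => z; rewrite derive_coord.
rewrite [X in X <= _]dotpE.
apply: (@le_trans _ _ (\sum_(k < n) (`|L| * dotp e e) ^+ 2)).
  apply: ler_sum => k _; rewrite -expr2 -real_normK ?num_real//.
  by rewrite ler_sqr ?nnegrE// mulr_ge0 ?dotp_ge0.
rewrite sumr_const card_ord -[X in X <= _]mulr_natl exprMn real_normK ?num_real//.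
by rewrite mulrA.
Qed.

End ObservableForm.

(** * Convergence of the extended Kalman filter *)

Lemma is_derive_entry (R : realType) (a b : nat) (M : R -> 'M[R]_(a, b)) (t : R) D :
  derivable M t 1 -> 'D_1 M t = D ->
  forall i j, is_derive t 1 (fun s => M s i j) (D i j).
Proof.
move=> dM <- i j; split; first by move/derivable_mxP: dM; exact.
by rewrite derive_mx// mxE.
Qed.

Lemma cvg_entry (R : realType) (a b : nat) (M : R -> 'M[R]_(a, b)) 
    (F : set_system R) {FF : Filter F} (l : 'M[R]_(a, b)) :
  M @ F --> l -> forall i j, (fun s => M s i j) @ F --> l i j.
Proof.
move=> cM i j.
apply: (@continuous_cvg _ _ _ _ FF M (fun B : 'M[R]_(a, b) => B i j)) => //.
exact: coord_continuous.
Qed.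

Theorem mainTheorem1 (R : realType) (p m : nat) (l : 'I_p -> nat)
  (U : set 'cV[R]_m)
  (fbar : 'cV[R]_(dimn l) * 'cV[R]_m -> 'cV[R]_(dimn l))
  (hbar : 'cV[R]_m -> 'cV[R]_p)
  (L : R) (G P0 : 'M[R]_(dimn l)) :
  (* structure of the observable form: 1 <= l_1 <= ... <= l_p *)
  (forall i : 'I_p, (1 <= l i)%N) ->
  (forall i j : 'I_p, (i <= j)%N -> (l i <= l j)%N) ->
  (* f(x,u) = Abar x + fbar(x,u), h(x,u) = Cbar x + hbar(u) are C^2 *)
  C2 (fun z : 'cV[R]_(dimn l) * 'cV[R]_m => Abar R l *m z.1 + fbar z) ->
  C2 (fun z : 'cV[R]_(dimn l) * 'cV[R]_m => Cbar R l *m z.1 + hbar z.2) ->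
  (* (i) observable form, Lipschitz *)
  observable_form U fbar ->
  lipschitz_form U fbar L ->
  (* (ii) bounded second derivative *)
  bounded_d2 U fbar L ->
  (* (iv) G invertible *)
  G \in unitmx ->
  (* P(0) positive definite *)
  posdef P0 ->
  exists2 eps : R, 0 < eps &
  forall (u : R -> 'cV[R]_m) (x xhat : R -> 'cV[R]_(dimn l))
         (P : R -> 'M[R]_(dimn l)),
    let f := fun z : 'cV[R]_(dimn l) * 'cV[R]_m => Abar R l *m z.1 + fbar z in
    let h := fun z : 'cV[R]_(dimn l) * 'cV[R]_m => Cbar R l *m z.1 + hbar z.2 in
    let y := fun t => h (x t, u t) in
    let A := fun t => jac_x f (xhat t) (u t) in
    let C := fun t => jac_x h (xhat t) (u t) in
    let Gamma := G *m G^T in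
    (forall t, 0 <= t -> U (u t)) ->
    (* (iii) x is a state trajectory of the system on [0, +oo) *)
    (forall t, 0 < t -> derivable x t 1 /\ 'D_1 x t = f (x t, u t)) ->
    x @ (0 : R)^'+ --> x 0 ->
    (* (v) xhat, P solve the extended Kalman filter on [0, +oo) *)
    (forall t, 0 < t -> derivable xhat t 1 /\
       'D_1 xhat t = f (xhat t, u t) + P t *m (C t)^T *m (y t - h (xhat t, u t))) ->
    xhat @ (0 : R)^'+ --> xhat 0 ->
    (forall t, 0 < t -> derivable P t 1 /\
       'D_1 P t = A t *m P t + P t *m (A t)^T + Gamma
                  - P t *m (C t)^T *m C t *m P t) ->
    P @ (0 : R)^'+ --> P 0 ->
    P 0 = P0 ->
    (* small initial error *)
    enorm (x 0 - xhat 0) < eps ->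
    (* exponential convergence of the estimation error *)
    exists M a : R, 0 < a /\
      forall t, 0 <= t -> enorm (x t - xhat t) <= M * expR (- (a * t)).
Proof.
move=> _ _ C2f _ _ lip d2 uG pP0.
have [gamma gamma0 hGamma] := gram_coercive uG.
have L0 : 0 <= `|L| by [].
have [S [delta [pS delta0 lyapS]]] := @observability_lyapunov R p l `|L| L0.
have /posdefP[symP0 _] := pP0.
have [M M0 hM] := @riccati_bounded R _ _ S P0 (G *m G^T) (Cbar R l) delta pS delta0 symP0.
have [eps [K [a [eps0 a0 hdecay]]]] := @error_decay R _ _ P0 (G *m G^T) (Cbar R l) M gamma
  ((dimn l)%:R * L ^+ 2) pP0 M0 gamma0 hGamma.
exists (Num.sqrt eps); first by rewrite sqrtr_gt0.
move=> u x xhat P f h y A C Gamma Uu dx cx dxh cxh dP cP P0E e0.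
have CE t : C t = Cbar R l by exact: jac_output.
have AE t : A t = Abar R l + jac_x fbar (xhat t) (u t) by exact: jac_dynamics.
have jac0 t k k' : 0 <= t -> (pos k < pos k')%N ->
    jac_x fbar (xhat t) (u t) k k' = 0.
  move=> t0 kk'; have := jac_fbar_bound C2f lip (xhat t) k k' (Uu t t0).
  by rewrite leqNgt kk' /= normr_le0 => /eqP.
have jacL t k k' : 0 <= t -> `|jac_x fbar (xhat t) (u t) k k'| <= `|L|.
  move=> t0; apply: le_trans (jac_fbar_bound C2f lip (xhat t) k k' (Uu t t0)) _.
  by case: ifP.
have solP : riccati_solution A P Gamma (Cbar R l).
  split; last exact: cvg_entry.
  move=> t t0; have [dPt DPt] := dP t t0; apply: is_derive_entry => //.
  by rewrite DPt CE.
have symP t : 0 <= t -> (P t)^T = P t.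
  move: t; apply: (riccati_sym (K := 1 + `|L|) solP).
  - by rewrite addr_ge0.
  - move=> t /ltW t0 i j; rewrite AE mxE; apply: le_trans (ler_normD _ _) _.
    by apply: lerD; [exact: Abar_norm|exact: jacL].
  - by rewrite /Gamma trmx_mul trmxK.
  - by rewrite P0E.
have PM : forall t, 0 <= t -> forall v, dotp v (P t *m v) <= M * dotp v v.
  apply: (hM A P solP P0E symP) => t /ltW t0 v; rewrite AE.
  by apply: lyapS => k k'; [exact: jacL|exact: jac0].
pose e t := x t - xhat t.
(* With this linearisation remainder the error equation reads e' = (A - P C^T C) e + r, because the
   output map is affine in the state and y - h = C e. *)
pose r t := f (x t, u t) - f (xhat t, u t) - A t *m e t.
have decay : forall t, 0 <= t -> dotp (e t) (e t) <= K * expR (- (a * t)).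
  apply: (hdecay A P e r solP P0E symP PM).
  - move=> t t0 i; have [dxt Dxt] := dx t t0; have [dht Dht] := dxh t t0.
    have h1 := is_derive_entry dxt Dxt i 0; have h2 := is_derive_entry dht Dht i 0.
    have -> : (fun s => e s i 0) = (fun s => x s i 0) - (fun s => xhat s i 0).
      by apply/funext => s; rewrite !mxE.
    apply: is_derive_eq; rewrite CE.
    have -> : y t - h (xhat t, u t) = Cbar R l *m e t.
      by rewrite /y /h /e /= mulmxBr opprD addrACA subrr addr0.
    rewrite /r; set fx := f (x t, u t); set fh := f (xhat t, u t).
    rewrite mulmxBl -!mulmxA; set q := P t *m _; set w := A t *m e t.
    by clearbody q w fx fh; rewrite !mxE; ring.
  - move=> i; have -> : (fun s => e s i 0) = (fun s => x s i 0) - (fun s => xhat s i 0).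
      by apply/funext => s; rewrite !mxE.
    have -> : e 0 i 0 = x 0 i 0 - xhat 0 i 0 by rewrite !mxE.
    by apply: cvgB; exact: cvg_entry.
  - move=> t /ltW t0.
    exact: (dynamics_remainder C2f d2 (Uu t t0)).
  - by move: e0; rewrite enormE -/(e 0) ltr_sqrt.
(* [decay] concerns the squared norm: the square root halves the rate, and the absolute value makes
   it applicable to [K], whose sign is not recorded. *)
exists (Num.sqrt `|K|), (a / 2); split=> [|t t0]; first exact: divr_gt0.
rewrite enormE.
have -> : expR (- (a / 2 * t)) = Num.sqrt (expR (- (a * t))).
  rewrite (_ : - (a * t) = - (a / 2 * t) + - (a / 2 * t)); last by field.
  by rewrite expRD -expr2 sqrtr_sqr ger0_norm// expR_ge0.
rewrite -sqrtrM// ler_wsqrtr//; apply: le_trans (decay t t0) _.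
by rewrite ler_wpM2r ?expR_ge0// ler_norm.
Qed.
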